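(* There exist universal constants $c_1, C, C'>0$ such that the following holds. Let $\bm{M}^\star=\lambda^\star\bm{u}^\star\bm{v}^{\star\top}\in\mathbb{R}^{n_1\times n_2}$ be a rank-1 matrix with leading singular value $\lambda^\star>0$ ($\|\bm{u}^\star\|_2=\|\bm{v}^\star\|_2=1$) and incoherence parameter $\mu$, and put $n=n_1+n_2$. Let $\bm{M}_1=\bm{M}^\star+\bm{H}_1$ and $\bm{M}_2=\bm{M}^\star+\bm{H}_2$, where $\bm{H}_1,\bm{H}_2\in\mathbb{R}^{n_1\times n_2}$ are independent random matrices each satisfying the noise assumption with parameters $\sigma,B$ (see context). Let $\lambda_1^{\mathsf d}\ge\lambda_2^{\mathsf d}$ be the two leading eigenvalues of $$\bm{M}_{\mathsf d}=\begin{bmatrix}\bm{0}&\bm{M}_1\\ \bm{M}_2^\top&\bm{0}\end{bmatrix}\in\mathbb{R}^{n\times n}.$$ If $$\frac{\max\{\sigma\sqrt{n\log n},\,B\log n\}}{\lambda^\star}\le c_1,$$ then with probability at least $1-C'n^{-10}$, $$\max\big\{|\lambda_1^{\mathsf d}-\lambda^\star|,\,|\lambda_2^{\mathsf d}+\lambda^\star|\big\}\le C\max\{\sigma\sqrt{n\log n},\,B\log n\}\sqrt{\frac{\mu}{n}}.$$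
   Context: Noise assumption with parameters $\sigma\ge 0$, $B>0$ on a random matrix $\bm{H}=[H_{ij}]\in\mathbb{R}^{n_1\times n_2}$ (with $n=n_1+n_2$): (1) the entries are independent (not necessarily identically distributed); (2) $\mathbb{E}[H_{ij}]=0$; (3) $\mathrm{Var}(H_{ij})\le\sigma^2$; (4) each $H_{ij}$ satisfies either (a) $|H_{ij}|\le B$, or (b) $H_{ij}$ has a symmetric distribution with $\mathbb{P}\{|H_{ij}|>B\}\le c_{\mathrm b}n^{-12}$, where $c_{\mathrm b}>0$ is a fixed universal constant. Incoherence parameter $\mu$: the smallest number such that all entries of the eigenvectors $\frac{1}{\sqrt2}\binom{\bm{u}^\star}{\bm{v}^\star}$ and $\frac{1}{\sqrt2}\binom{\bm{u}^\star}{-\bm{v}^\star}$ of the symmetric rank-2 matrix $\begin{bmatrix}\bm{0}&\bm{M}^\star\\ \bm{M}^{\star\top}&\bm{0}\end{bmatrix}$ (associated with its eigenvalues $\lambda^\star$ and $-\lambda^\star$) are at most $\sqrt{\mu/n}$ in magnitude. The two leading eigenvalues of $\bm{M}_{\mathsf d}$ are its two eigenvalues of largest modulus; they are labelled in decreasing order of real part (so $\lambda_1^{\mathsf d}\ge\lambda_2^{\mathsf d}$ when they are real). *)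

(* Defs.v *)
From HB Require Import structures.
From mathcomp Require Export all_boot all_order all_algebra.
From mathcomp Require Export all_classical all_reals all_analysis.
From mathcomp Require Export complex.
Export Order.TTheory GRing.Theory Num.Theory.
Export numFieldNormedType.Exports.
Export ComplexField.Normc.

Set Implicit Arguments.
Unset Strict Implicit.
Unset Printing Implicit Defensive.

Local Open Scope classical_set_scope.
Local Open Scope complex_scope.
Local Open Scope ring_scope.

Definition l2norm (R : realType) (m : nat) (x : 'cV[R]_m) : R :=
  Num.sqrt (\sum_(i < m) x i 0 ^+ 2).

(* All subfamilies are covered by quantifying over [J]. *)
Definition mutually_independent d (T : measurableType d) (R : realType)
    (P : probability T R) (I : finType) (X : I -> {RV P >-> R}) : Prop :=
  forall (J : {set I}) (A : I -> set R),
    (forall i, i \in J -> measurable (A i)) ->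
    P (\bigcap_(i in [set` J]) X i @^-1` A i) =
    (\prod_(i in J) P (X i @^-1` A i))%E.

Definition sigma_of d (T : measurableType d) (R : realType)
    (P : probability T R) (I : finType) (X : I -> {RV P >-> R}) :
    set (set T) :=
  <<s \bigcup_(i in [set: I]) g_sigma_algebra_preimage (X i) >>.

Definition independent_families d (T : measurableType d) (R : realType)
    (P : probability T R) (I J : finType)
    (X : I -> {RV P >-> R}) (Y : J -> {RV P >-> R}) : Prop :=
  forall E F : set T, sigma_of X E -> sigma_of Y F ->
    P (E `&` F) = (P E * P F)%E.

Definition symmetric_distribution d (T : measurableType d) (R : realType)
    (P : probability T R) (X : {RV P >-> R}) : Prop :=
  forall A : set R, measurable A ->
    P (X @^-1` A) = P ((fun w => - X w) @^-1` A).

(* A random matrix is given by the family of its entries, indexed by pairs. *)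
Definition rmatrix d (T : measurableType d) (R : realType)
    (P : probability T R) (n1 n2 : nat) : Type :=
  'I_n1 * 'I_n2 -> {RV P >-> R}.

Definition rmx_at d (T : measurableType d) (R : realType)
    (P : probability T R) (n1 n2 : nat) (H : rmatrix P n1 n2) (w : T) :
    'M[R]_(n1, n2) :=
  \matrix_(i, j) H (i, j) w.

Record noise_assumption d (T : measurableType d) (R : realType)
    (P : probability T R) (n1 n2 : nat) (cb sigma B : R)
    (H : rmatrix P n1 n2) : Prop := NoiseAssumption {
  noise_independent : mutually_independent H;
  (* Integrability is implicit in the mean being defined. *)
  noise_integrable : forall ij, P.-integrable [set: T] (EFin \o H ij);
  noise_centered : forall ij, ('E_P[H ij] = 0)%E;
  noise_variance : forall ij, ('V_P[H ij] <= (sigma ^+ 2)%R%:E)%E;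
  noise_tail : forall ij,
    {ae P, forall w, `|H ij w| <= B} \/
    (symmetric_distribution (H ij) /\
     (P [set w | (B < `|H ij w|)%R] <= (cb * (n1 + n2)%:R ^- 12)%R%:E)%E)
}.

Definition incoherence_bound (R : realType) (n1 n2 : nat)
    (u : 'cV[R]_n1) (v : 'cV[R]_n2) (mu : R) : Prop :=
  0 <= mu /\
  forall k : 'I_(n1 + n2),
    `|((Num.sqrt 2)^-1 *: col_mx u v) k 0| <= Num.sqrt (mu / (n1 + n2)%:R) /\
    `|((Num.sqrt 2)^-1 *: col_mx u (- v)) k 0|
      <= Num.sqrt (mu / (n1 + n2)%:R).

Definition incoherence_parameter (R : realType) (n1 n2 : nat)
    (u : 'cV[R]_n1) (v : 'cV[R]_n2) (mu : R) : Prop :=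
  incoherence_bound u v mu /\
  forall mu', incoherence_bound u v mu' -> mu <= mu'.

(* [A] need not be symmetric: its eigenvalues are the complex roots of its
   characteristic polynomial, listed with algebraic multiplicity.  When the
   moduli or the real parts tie, every admissible choice satisfies the
   predicate. *)
Definition leading_eigenvalues (R : realType) (m : nat) (A : 'M[R]_m)
    (l1 l2 : R[i]) : Prop :=
  (exists s : seq R[i],
     char_poly (map_mx (real_complex R) A) =
       \prod_(z <- [:: l1, l2 & s]) ('X - z%:P) /\
     (forall z, z \in s -> normc z <= normc l1 /\ normc z <= normc l2)) /\
  complex.Re l2 <= complex.Re l1.

Definition noise_level (R : realType) (n : nat) (sigma B : R) : R :=
  Num.max (sigma * Num.sqrt (n%:R * ln n%:R)) (B * ln n%:R).

(* "[Q] holds with probability at least [p]": [P] is meaningful on measurable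
   sets only, hence the measurable event inside [Q]. *)
Definition with_probability_at_least d (T : measurableType d) (R : realType)
    (P : probability T R) (p : R) (Q : T -> Prop) : Prop :=
  exists E : set T,
    [/\ measurable E, (p%:E <= P E)%E & forall w, E w -> Q w].

(* Main.v *)
Require Import Defs.
From mathcomp Require Import measurable_realfun zify ring lra.

(** Write [H] for the block matrix with off-diagonal blocks [H1] and [H2^T], and
    [a = (u, 0)], [b = (0, v)], so that [Md = lambda (a b^T + b a^T) + H].

    Since the entries of [H] are independent and [H] is not symmetric, the
    bilinear forms [x^T H^k y] are much smaller than the norm of [H^k]: a moment
    of order [log n] is a sum over families of walks in which every directed
    edge is traversed at least twice, and it gives
    [|x^T H^k y| <= ||y||_oo rho^k] for unit vectors [x], [y] and all [k >= 1],
    where [rho] is a multiple of the noise level.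

    For [|z| > rho] the resolvent of [H] exists and the matrix determinant lemma
    turns [det (z - Md) = 0] into a 2 x 2 determinantal equation involving only
    [x^T (z - H)^-1 y] with [x, y] in [{a, b}].  It is a Lipschitz-small
    perturbation of [z^2 = lambda^2]: the intermediate value theorem gives a
    root near each of [lambda] and [-lambda], the Lipschitz bound shows that
    both are simple, and there is no other root with [|z| >= lambda / 2]. *)

Set Implicit Arguments.
Unset Strict Implicit.
Unset Printing Implicit Defensive.
Local Open Scope complex_scope.
Local Open Scope ring_scope.

(** * The spectrum of a rank-two perturbation *)

(** The overview leaves three points open. The noise may be unbounded, while moments of order
    [log n] need bounded entries. Each entry is therefore replaced by [0] outside [[-B, B]]. The
    symmetric cut preserves the zero mean of a symmetric entry, and a union bound over the entries
    shows that nothing changes outside an event of probability at most [cb * n ^- 10]. A union bound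
    reaches finitely many exponents only, here [k <= N] with [N] of order [log n]. Longer powers are
    cut into blocks of length [N]; a block costs a factor [n <= e ^ N], that is, [e] per step, which
    only enlarges the constant in [rho]. Powers of the noise are thus controlled entry by entry,
    without operator norms. A Lipschitz bound separates distinct roots but does not see
    multiplicity. A double eigenvalue is excluded by orders of vanishing: the characteristic
    polynomial would be quadratically small near it, whereas the secular function decays only
    linearly. So the two leading eigenvalues, counted with multiplicity, lie near different points
    of [{lam, -lam}]. *)

Section Normc.
Variable R : realType.
Implicit Types x y z : R[i].

Lemma normc_ge0 z : 0 <= normc z.
Proof. by case: z => a b /=; rewrite sqrtr_ge0. Qed.

Lemma normcX z k : normc (z ^+ k) = normc z ^+ k.
Proof.
elim: k => [|k IH]; first by rewrite !expr0 normc1.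
by rewrite !exprS normcM IH.
Qed.

Lemma normcR (a : R) : normc a%:C = `|a|.
Proof. by rewrite /= expr0n /= addr0 sqrtr_sqr. Qed.

Lemma normcDle x y a b : normc x <= a -> normc y <= b -> normc (x + y) <= a + b.
Proof. by move=> xa yb; rewrite (le_trans (le_normcD _ _))// lerD. Qed.

Lemma normcBle x y a b : normc x <= a -> normc y <= b -> normc (x - y) <= a + b.
Proof. by move=> xa yb; apply: normcDle; rewrite ?normcN. Qed.

Lemma normcMle x y a b : normc x <= a -> normc y <= b -> normc (x * y) <= a * b.
Proof. by move=> xa yb; rewrite normcM ler_pM// normc_ge0. Qed.

Lemma normcB_ge x y : normc x - normc y <= normc (x - y).
Proof.
by rewrite lerBlDr; have := le_normcD (x - y) y; rewrite subrK.
Qed.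

Lemma normc_sum_le (I : Type) (r : seq I) (Q : pred I) (F : I -> R[i]) :
  normc (\sum_(i <- r | Q i) F i) <= \sum_(i <- r | Q i) normc (F i).
Proof.
elim/big_ind2 : _ => //; first by rewrite normc0.
by move=> x a y b; exact: normcDle.
Qed.

Lemma normc_eq0 z : (normc z == 0) = (z == 0).
Proof. by apply/eqP/eqP => [/eq0_normc|->]; rewrite ?normc0. Qed.

Lemma normc_ge_Re z : `|complex.Re z| <= normc z.
Proof.
by case: z => a b /=; rewrite -sqrtr_sqr ler_wsqrtr// lerDl sqr_ge0.
Qed.

Lemma normcX_sub_le x y m k : normc x <= m -> normc y <= m ->
  normc (x ^+ k.+1 - y ^+ k.+1) <= normc (x - y) * (k.+1%:R * m ^+ k).
Proof.
move=> xm ym; have m0 : 0 <= m by rewrite (le_trans (normc_ge0 x)).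
rewrite subrXX normcM ler_wpM2l ?normc_ge0// (le_trans (normc_sum_le _ _ _))//.
apply: (@le_trans _ _ (\sum_(i < k.+1) m ^+ k)).
  apply: ler_sum => i _; rewrite normcM !normcX.
  have -> : m ^+ k = m ^+ (k - i) * m ^+ i.
    by rewrite -exprD subnK// -ltnS.
  rewrite /= ?subSS.
  by rewrite ler_pM ?exprn_ge0 ?normc_ge0// lerXn2r ?nnegrE ?normc_ge0.
by rewrite sumr_const card_ord mulr_natl.
Qed.

Lemma normc_poly_bounded (p : {poly R[i]}) z :
  exists K, forall t : R, 0 <= t <= 1 -> normc p.[z + t%:C] <= K.
Proof.
exists (\sum_(i < size p) normc p`_i * (normc z + 1) ^+ i) => t /andP[t0 t1].
rewrite horner_coef (le_trans (normc_sum_le _ _ _))//; apply: ler_sum => i _.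
rewrite normcM ler_wpM2l ?normc_ge0// normcX.
rewrite lerXn2r ?nnegrE ?normc_ge0 ?addr_ge0 ?normc_ge0//.
by apply: normcDle => //; rewrite normcR ger0_norm.
Qed.

End Normc.

(** * Elementary limits and geometric sums *)

Section Limits.
Variable R : realType.

Lemma le_of_halving (a b c : R) : (forall k : nat, a <= b + c / 2 ^+ k) -> a <= b.
Proof.
move=> H; rewrite leNgt; apply/negP => ba.
have d0 : 0 < a - b by lra.
have := H (Num.truncn (c / (a - b))).+1; set k := Num.truncn _.
have hk : c / (a - b) < k.+1%:R by exact: truncnS_gt.
rewrite ltr_pdivrMr// in hk.
have h2 : k.+1%:R <= 2 ^+ k.+1 :> R by rewrite -natrX ler_nat ltnW// ltn_expl.
have p0 : 0 < 2 ^+ k.+1 :> R by rewrite exprn_gt0.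
rewrite addrC -lerBlDr ler_pdivlMr// mulrC => h.
have : k.+1%:R * (a - b) <= 2 ^+ k.+1 * (a - b) by rewrite ler_wpM2r// ltW.
lra.
Qed.

(** Compares orders of vanishing at a root: once divided by [t], a quadratic bound still tends to
    [0]. *)
Lemma le0_of_small (c K t0 : R) : 0 < t0 ->
  (forall t, 0 < t <= t0 -> c <= t * K) -> c <= 0.
Proof.
move=> t00 H; rewrite leNgt; apply/negP => c0.
have K0 : 0 < K by rewrite -(pmulr_rgt0 _ t00) (lt_le_trans c0)// H// t00 lexx.
have := H (Num.min t0 (c / (2 * K))).
rewrite lt_min t00 divr_gt0 ?mulr_gt0//= ge_min lexx => /(_ isT).
apply/negP; rewrite -ltNge.
apply: (@le_lt_trans _ _ (c / (2 * K) * K)).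
  by rewrite ler_wpM2r ?(ltW K0)// ge_min lexx orbT.
rewrite (_ : _ * K = c / 2); first lra.
by field; rewrite gt_eqF.
Qed.

(** [2] and [4] are the values of [1 / (1 - r)] and [1 / (1 - r) ^+ 2] at [r = 1/2], where the
    partial sums have closed forms. *)
Lemma geometric_half_le (r : R) K : 0 <= r <= 2^-1 ->
  \sum_(k < K) r ^+ k <= 2 /\ \sum_(k < K) k.+1%:R * r ^+ k <= 4.
Proof.
move=> /andP[r0 r2].
have rk k : r ^+ k <= 2^-1 ^+ k by rewrite lerXn2r ?nnegrE ?invr_ge0.
have p0 k : 0 < 2^-1 ^+ k :> R by rewrite exprn_gt0.
have e1 : \sum_(k < K) 2^-1 ^+ k = 2 - 2 * 2^-1 ^+ K :> R.
  elim: K => [|K IH]; first by rewrite big_ord0 expr0; ring.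
  by rewrite big_ord_recr /= IH exprS; field.
have e2 : \sum_(k < K) k.+1%:R * 2^-1 ^+ k = 4 - (2 * K%:R + 4) * 2^-1 ^+ K :> R.
  elim: K {e1} => [|K IH]; first by rewrite big_ord0 expr0; ring.
  by rewrite big_ord_recr /= IH exprS -!natr1; field.
split.
  apply: (@le_trans _ _ (\sum_(k < K) 2^-1 ^+ k)); first exact: ler_sum.
  by rewrite e1; have := p0 K; lra.
apply: (@le_trans _ _ (\sum_(k < K) k.+1%:R * 2^-1 ^+ k)).
  by apply: ler_sum => k _; rewrite ler_wpM2l.
by rewrite e2 gerBl mulr_ge0 ?ltW ?addr_ge0 ?mulr_ge0 ?ler0n.
Qed.

End Limits.

(** * Determinant identities *)

Section Determinants.

Lemma det_mx2 (R : comPzRingType) (M : 'M[R]_2) :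
  \det M = M 0 0 * M 1 1 - M 0 1 * M 1 0.
Proof.
rewrite (expand_det_row _ ord0) !big_ord_recl big_ord0 addr0.
rewrite /cofactor !det_mx11 !mxE /= expr0 mul1r expr1 mulN1r mulrN.
by congr (_ * _ - _ * _); congr (M _ _); apply: val_inj.
Qed.

(** The matrix with blocks [A], [U], [W], [1] has two block-triangular factorizations, one for each
    eliminated diagonal block; their determinants agree. *)
Lemma det_subM (F : fieldType) n k (A : 'M[F]_n) (U : 'M[F]_(n, k))
    (W : 'M[F]_(k, n)) :
  A \in unitmx -> \det (A - U *m W) = \det A * \det (1%:M - W *m invmx A *m U).
Proof.
move=> uA.
have e1 : block_mx A U W 1%:M =
    block_mx 1%:M 0 (W *m invmx A) 1%:M *m block_mx A U 0 (1%:M - W *m invmx A *m U).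
  rewrite mulmx_block !mul1mx !mul0mx ?mulmx0 !addr0 mulmxKV//.
  by rewrite addrC subrK.
have e2 : block_mx A U W 1%:M =
    block_mx 1%:M U 0 1%:M *m block_mx (A - U *m W) 0 W 1%:M.
  by rewrite mulmx_block !mul1mx !mul0mx ?mulmx0 !mulmx1 !add0r subrK.
have := congr1 determinant (etrans (esym e1) e2).
by rewrite !det_mulmx !det_lblock !det_ublock !det1 !mul1r mulr1.
Qed.

Lemma horner_char_poly (F : comNzRingType) n (A : 'M[F]_n) z :
  (char_poly A).[z] = \det (z%:M - A).
Proof.
rewrite /char_poly -horner_evalE -det_map_mx; congr (\det _).
apply/matrixP => i j; rewrite !mxE /= horner_evalE.
by case: eqP => _; rewrite ?mulr1n ?mulr0n !hornerE.
Qed.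

End Determinants.

(** * The resolvent and its Neumann series *)

Section Resolvent.
Variables (R : realType) (n : nat) (H : 'M[R]_n) (rho : R).
Hypotheses (rho0 : 0 <= rho)
  (Hpow : forall k i j, `|(H ^+ k) i j| <= rho ^+ k).
Local Notation toC := (map_mx (real_complex R)).
Implicit Types (x y : 'cV[R]_n) (z : R[i]).

Lemma map_mx_exp k : toC (H ^+ k) = toC H ^+ k.
Proof.
elim: k => [|k IH]; first by rewrite !expr0; exact: map_mx1.
rewrite !exprS -IH; exact: map_mxM.
Qed.

(** A left eigenvector [v] for [z] satisfies [v H^n = z^n v], with the dimension [n] as exponent. In
    the l1 norm the entry bound gives [|z|^n <= n rho^n <= n (|z| / 2)^n], absurd since
    [n < 2^n]. *)
Lemma resolvent_unit z : 2 * rho <= normc z -> 0 < normc z ->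
  z%:M - toC H \in unitmx.
Proof.
move=> rz z0; rewrite unitmxE unitfE; apply/det0P => -[v vn0 vE].
have vH k : v *m toC H ^+ k = z ^+ k *: v.
  elim: k => [|k IH]; first by rewrite !expr0 mulmx1 scale1r.
  have e1 : v *m toC H = z *: v.
    by apply/eqP; rewrite -subr_eq0 -mul_mx_scalar -mulmxBr -oppr_eq0 -mulmxN opprB vE.
  have -> : toC H ^+ k.+1 = toC H *m toC H ^+ k by rewrite exprS.
  by rewrite mulmxA e1 -scalemxAl IH scalerA exprS.
have [j0 vj0] : exists j, v 0 j != 0.
  apply/existsP; apply: contraR vn0; rewrite negb_exists => /forallP h.
  by apply/eqP/rowP => j; rewrite mxE; apply/eqP; have := h j; rewrite negbK.
pose S := \sum_j normc (v 0 j).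
have S0 : 0 < S.
  rewrite /S (bigD1 j0)//= ltr_wpDr ?sumr_ge0// => [j _|]; first exact: normc_ge0.
  by rewrite lt_neqAle eq_sym normc_eq0 vj0 normc_ge0.
have le1 : normc z ^+ n * S <= n%:R * (rho ^+ n * S).
  rewrite {1}/S mulr_sumr.
  apply: (@le_trans _ _ (\sum_(j < n) rho ^+ n * S)); last first.
    by rewrite sumr_const card_ord mulr_natl.
  apply: ler_sum => j _; rewrite -normcX -normcM.
  have -> : z ^+ n * v 0 j = (v *m toC H ^+ n) 0 j by rewrite vH mxE.
  rewrite mxE (le_trans (normc_sum_le _ _ _))// /S mulr_sumr; apply: ler_sum => i _.
  rewrite normcM mulrC ler_wpM2r ?normc_ge0//.
  by rewrite -map_mx_exp mxE normcR.
move: le1; rewrite mulrA ler_pM2r// => le1.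
have : normc z ^+ n < normc z ^+ n.
  apply: (le_lt_trans le1).
  apply: (@le_lt_trans _ _ (n%:R * (normc z / 2) ^+ n)).
    rewrite ler_wpM2l// lerXn2r ?nnegrE// ?divr_ge0 ?normc_ge0//.
    by rewrite ler_pdivlMr// mulrC.
  rewrite expr_div_n mulrCA -[ltRHS]mulr1 ltr_pM2l ?exprn_gt0//.
  by rewrite ltr_pdivrMr ?exprn_gt0// mul1r -natrX ltr_nat ltn_expl.
by rewrite ltxx.
Qed.

Definition form x y k : R := (x^T *m H ^+ k *m y) 0 0.

(** For large [z] this is the sum over [k >= 1] of [form x y k / z ^+ k]: the factor [z] and the
    subtracted zeroth term leave the part of the Neumann series in which the smallness of the forms
    is available. *)
Definition phi x y z : R[i] :=
  z * ((toC x)^T *m invmx (z%:M - toC H) *m toC y) 0 0 - (form x y 0)%:C.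

(** Iterating [G = 1 + z^-1 H G] leaves the remainder [z^-(K+1) H^(K+1) G] with one fixed [G], whose
    entries go into [c]. Since [rho / |z| <= 1/2], the bound halves at each step. *)
Lemma phi_truncated x y z : 2 * rho <= normc z -> 0 < normc z ->
  exists c, forall K,
    normc (phi x y z - \sum_(k < K) (form x y k.+1)%:C * z^-1 ^+ k.+1) <= c / 2 ^+ K.
Proof.
move=> rz z0; have uz := resolvent_unit rz z0.
have zn0 : z != 0 by rewrite -normc_eq0 gt_eqF.
set G := z *: invmx (z%:M - toC H).
have GE : G = 1%:M + z^-1 *: (toC H *m G).
  rewrite /G -scalemxAr scalerA mulVf// scale1r.
  have := mulmxV uz; rewrite mulmxBl mul_scalar_mx => /eqP.
  by rewrite subr_eq => /eqP.
have GK K : G = \sum_(k < K.+1) z^-1 ^+ k *: toC H ^+ k + z^-1 ^+ K.+1 *: (toC H ^+ K.+1 *m G).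
  elim: K => [|K IH].
    by rewrite big_ord1 !expr0 scale1r; exact: GE.
  rewrite {1}IH [in RHS]big_ord_recr /= -addrA; congr (_ + _).
  rewrite {1}GE mulmxDr mulmx1 scalerDr; congr (_ + _).
  rewrite -scalemxAr scalerA -exprSr mulmxA; congr (_ *: (_ *m _)).
  exact: esym (exprSr _ _).
have trunc K : phi x y z - \sum_(k < K) (form x y k.+1)%:C * z^-1 ^+ k.+1 =
   z^-1 ^+ K.+1 * ((toC x)^T *m (toC H ^+ K.+1 *m G) *m toC y) 0 0.
  have scE (c : R[i]) (A : 'M[R[i]]_1) : (c *: A) 0 0 = c * A 0 0 by rewrite mxE.
  have formE k : ((toC x)^T *m toC H ^+ k *m toC y) 0 0 = (form x y k)%:C.
    by rewrite -map_mx_exp matrix.map_trmx -!map_mxM mxE.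
  have -> : phi x y z = ((toC x)^T *m G *m toC y) 0 0 - (form x y 0)%:C.
    by rewrite /phi /G -scalemxAr -scalemxAl [in RHS]mxE.
  rewrite [in LHS](GK K) mulmxDr mulmxDl mxE mulmx_sumr mulmx_suml summxE.
  rewrite big_ord_recl /= !expr0 scale1r.
  rewrite -[X in _ *m X *m _](expr0 (toC H)) formE.
  rewrite -(scalemxAr (z^-1 ^+ K.+1)) -(scalemxAl (z^-1 ^+ K.+1)).
  rewrite scE; under eq_bigr do rewrite -scalemxAr -scalemxAl scE formE mulrC.
  by set s := \sum_(i < K) _; ring.
pose c0 := \sum_j \sum_i `|x i 0| * normc ((G *m toC y) j 0).
exists c0 => K; rewrite trunc.
have c00 : 0 <= c0.
  by rewrite sumr_ge0// => j _; rewrite sumr_ge0// => i _; rewrite mulr_ge0 ?normc_ge0.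
have rz2 : rho / normc z <= 2^-1 by rewrite ler_pdivrMr//; lra.
apply: (@le_trans _ _ ((rho / normc z) ^+ K.+1 * c0)); last first.
  rewrite mulrC ler_wpM2l// -exprVn.
  apply: (@le_trans _ _ (2^-1 ^+ K.+1)).
    by rewrite lerXn2r ?nnegrE ?divr_ge0 ?normc_ge0 ?invr_ge0.
  by rewrite exprS ler_piMl ?exprn_ge0 ?invr_ge0//; lra.
rewrite normcM normcX normcV exprMn mulrAC [leRHS]mulrC ler_wpM2l ?exprn_ge0 ?invr_ge0 ?normc_ge0//.
rewrite -!mulmxA mulmxA mxE /c0 mulr_sumr (le_trans (normc_sum_le _ _ _))//.
apply: ler_sum => j _; rewrite normcM mxE mulr_sumr.
rewrite (le_trans (ler_wpM2r (normc_ge0 _) (normc_sum_le _ _ _)))// mulr_suml.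
apply: ler_sum => i _; rewrite normcM !mxE normcR.
by rewrite mulrA ler_wpM2r ?normc_ge0// mulrC ler_wpM2r// -map_mx_exp mxE normcR.
Qed.

Section Bounds.
Variables (x y : 'cV[R]_n) (eps : R).
Hypotheses (eps0 : 0 <= eps)
  (Hform : forall k, (0 < k)%N -> `|form x y k| <= eps * rho ^+ k).

Lemma phi_le z : 2 * rho <= normc z -> 0 < normc z ->
  normc (phi x y z) <= 2 * eps * rho / normc z.
Proof.
move=> rz z0; have [c cP] := phi_truncated x y rz z0.
apply: (@le_of_halving _ _ _ c) => K.
have := normcB_ge (phi x y z) (\sum_(k < K) (form x y k.+1)%:C * z^-1 ^+ k.+1).
have := cP K; set s := \sum_(k < K) _.
suff : normc s <= 2 * eps * rho / normc z by lra.
rewrite /s (le_trans (normc_sum_le _ _ _))//.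
have r2 : 0 <= rho / normc z <= 2^-1.
  by rewrite divr_ge0 ?(ltW z0)//= ler_pdivrMr//; lra.
apply: (@le_trans _ _ (eps * rho / normc z * \sum_(k < K) (rho / normc z) ^+ k)).
  rewrite mulr_sumr; apply: ler_sum => k _.
  rewrite normcM normcR normcX normcV.
  apply: (@le_trans _ _ (eps * rho ^+ k.+1 * (normc z)^-1 ^+ k.+1)).
    by rewrite ler_wpM2r ?exprn_ge0 ?invr_ge0 ?normc_ge0// Hform.
  by rewrite le_eqVlt exprMn !exprS; apply/orP; left; apply/eqP; ring.
have [h _] := geometric_half_le K r2.
have -> : 2 * eps * rho / normc z = eps * rho / normc z * 2 by ring.
by rewrite ler_wpM2l// divr_ge0 ?normc_ge0// mulr_ge0.
Qed.

(** Termwise, a difference of powers of order [k + 1] costs a factor [k + 1]; the differentiated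
    geometric series that results is at most [4]. *)
Lemma phi_lipschitz z z' : 2 * rho <= normc z -> 0 < normc z ->
  2 * rho <= normc z' -> 0 < normc z' ->
  normc (phi x y z - phi x y z') <= 4 * eps * rho * normc (z^-1 - z'^-1).
Proof.
move=> rz z0 rz' z'0.
have [c cP] := phi_truncated x y rz z0; have [c' cP'] := phi_truncated x y rz' z'0.
apply: (@le_of_halving _ _ _ (c + c')) => K.
have h := cP K; have h' := cP' K.
set s := \sum_(k < K) (form x y k.+1)%:C * z'^-1 ^+ k.+1 in h'.
set s' := \sum_(k < K) (form x y k.+1)%:C * z^-1 ^+ k.+1 in h.
have e : phi x y z - phi x y z' =
    (phi x y z - s') - (phi x y z' - s) + (s' - s) by ring.
rewrite e [(c + c') / _]mulrDl [leRHS]addrC; apply: normcDle; first exact: normcBle.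
pose m := Num.max (normc z^-1) (normc z'^-1).
have zm : normc z^-1 <= m by rewrite le_max lexx.
have z'm : normc z'^-1 <= m by rewrite le_max lexx orbT.
have m0 : 0 <= m by rewrite (le_trans (normc_ge0 _) zm).
have r2 : 0 <= rho * m <= 2^-1.
  rewrite mulr_ge0//= /m; case: (leP (normc z^-1) (normc z'^-1)) => _; rewrite normcV ler_pdivrMr//; lra.
rewrite /s /s' -sumrB (le_trans (normc_sum_le _ _ _))//.
apply: (@le_trans _ _ (eps * rho * normc (z^-1 - z'^-1) *
    \sum_(k < K) k.+1%:R * (rho * m) ^+ k)).
  rewrite mulr_sumr; apply: ler_sum => k _.
  rewrite -mulrBr normcM normcR.
  apply: (@le_trans _ _ (eps * rho ^+ k.+1 *
     (normc (z^-1 - z'^-1) * (k.+1%:R * m ^+ k)))).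
    rewrite ler_pM ?normc_ge0 ?Hform//.
    exact: normcX_sub_le.
  by rewrite le_eqVlt exprMn !exprS; apply/orP; left; apply/eqP; ring.
have [_ h4] := geometric_half_le K r2.
have -> : 4 * eps * rho * normc (z^-1 - z'^-1) =
   eps * rho * normc (z^-1 - z'^-1) * 4 by ring.
by rewrite ler_wpM2l// !mulr_ge0 ?normc_ge0.
Qed.

End Bounds.
End Resolvent.

Lemma normc_sub_ge (R : realType) (x w : R[i]) :
  normc x - normc (w - x) <= normc w.
Proof.
have e : x - (x - w) = w by ring.
by have := normcB_ge x (x - w); rewrite e -[x - w]opprB normcN.
Qed.

(** * Perturbations of the equation [z ^+ 2 = lam ^+ 2] *)

Section PerturbedEquation.
Variables (R : realType) (lam th : R) (f1 f2 f3 f4 : R[i] -> R[i]).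
Hypotheses (lam0 : 0 < lam) (th0 : 0 <= th) (th1 : 100 * th <= 1).
(** The Lipschitz constant is what [|z^-1 - z'^-1| <= (2 / lam)^2 |z - z'|], valid on this domain,
    yields for [phi] when [th] is [4 * eps * rho / lam]. *)
Definition small_lipschitz (f : R[i] -> R[i]) :=
  (forall z, lam / 2 <= normc z -> normc (f z) <= th) /\
  (forall z z', lam / 2 <= normc z -> lam / 2 <= normc z' ->
     normc (f z - f z') <= 4 * th / lam * normc (z - z')).
Hypotheses (Hf1 : small_lipschitz f1) (Hf2 : small_lipschitz f2)
  (Hf3 : small_lipschitz f3) (Hf4 : small_lipschitz f4).
Implicit Types z : R[i].

(** [z ^+ 2] times the 2 x 2 determinant, with [f1], [f2], [f3], [f4] in the role of [phi] at the
    pairs [(b, a)], [(a, b)], [(a, a)], [(b, b)]. The summands [1] are the squared norms of [a] and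
    [b]; with all [f] zero it is [z ^+ 2 - lam ^+ 2]. *)
Definition secular z : R[i] :=
  (z - lam%:C * f1 z) * (z - lam%:C * f2 z)
  - lam%:C ^+ 2 * ((1 + f3 z) * (1 + f4 z)).

Lemma normc_lam : normc lam%:C <= lam.
Proof. by rewrite normcR gtr0_norm. Qed.

Lemma secular_close z : lam / 2 <= normc z ->
  normc (secular z - (z ^+ 2 - lam%:C ^+ 2)) <=
  lam * (2 * th * normc z + 3 * th * lam).
Proof.
move=> zl.
have h1 := Hf1.1 _ zl; have h2 := Hf2.1 _ zl.
have h3 := Hf3.1 _ zl; have h4 := Hf4.1 _ zl.
have hl := normc_lam.
have -> : secular z - (z ^+ 2 - lam%:C ^+ 2) =
   lam%:C * (lam%:C * (f1 z * f2 z) - z * (f1 z + f2 z))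
   - lam%:C ^+ 2 * (f3 z + f4 z + f3 z * f4 z) by rewrite /secular; ring.
apply: (@le_trans _ _ (lam * (lam * (th * th) + normc z * (th + th)) +
   lam ^+ 2 * (th + th + th * th))).
  apply: normcBle; apply: normcMle => //.
  - apply: normcBle; apply: normcMle => //; first exact: normcMle.
    exact: normcDle.
  - by rewrite expr2; apply: normcMle.
  - by apply: normcDle; [exact: normcDle|exact: normcMle].
have -> : lam * (lam * (th * th) + normc z * (th + th)) +
   lam ^+ 2 * (th + th + th * th) =
   lam * (2 * th * normc z + (2 * th * th + 2 * th) * lam) by ring.
have tt : 100 * (th * th) <= th by rewrite mulrA ler_piMl.
rewrite ler_wpM2l ?(ltW lam0)// lerD2l ler_wpM2r ?(ltW lam0)//.
have := th0; lra.
Qed.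

Lemma secular_lipschitz z z' : lam / 2 <= normc z -> lam / 2 <= normc z' ->
  normc z' <= 2 * lam ->
  normc (secular z - secular z' - (z ^+ 2 - z' ^+ 2)) <= 40 * th * lam * normc (z - z').
Proof.
move=> zl zl' z'u; set D := normc (z - z').
have D0 : 0 <= D by exact: normc_ge0.
have h1 := Hf1.1 _ zl; have h2 := Hf2.1 _ zl.
have h3 := Hf3.1 _ zl; have h4 := Hf4.1 _ zl.
have h1' := Hf1.1 _ zl'; have h3' := Hf3.1 _ zl'.
have L1 := Hf1.2 _ _ zl zl'; have L2 := Hf2.2 _ _ zl zl'.
have L3 := Hf3.2 _ _ zl zl'; have L4 := Hf4.2 _ _ zl zl'.
rewrite -/D in L1 L2 L3 L4.
have hl := normc_lam; have hD : normc (z - z') <= D by [].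
pose l := 4 * th / lam * D; rewrite -/l in L1 L2 L3 L4.
(* The products are telescoped so that the bare factor in front of the differences of [f1] and [f2]
   is [z']; an upper bound on [normc z'] alone then suffices. *)
have -> : secular z - secular z' - (z ^+ 2 - z' ^+ 2) =
   lam%:C * (lam%:C * ((f1 z - f1 z') * f2 z + f1 z' * (f2 z - f2 z'))
     - ((z - z') * (f1 z + f2 z) + z' * ((f1 z - f1 z') + (f2 z - f2 z'))))
   - lam%:C ^+ 2 * ((f3 z - f3 z') + (f4 z - f4 z') +
       ((f3 z - f3 z') * f4 z + f3 z' * (f4 z - f4 z'))).
  by rewrite /secular; ring.
apply: (@le_trans _ _ (lam * (lam * (l * th + th * l) +
     (D * (th + th) + 2 * lam * (l + l))) + lam ^+ 2 * (l + l + (l * th + th * l)))).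
  apply: normcBle; apply: normcMle => //.
  - apply: normcBle.
      by apply: normcMle => //; apply: normcDle; apply: normcMle.
    by apply: normcDle; apply: normcMle => //; apply: normcDle.
  - by rewrite expr2; apply: normcMle.
  - apply: normcDle; first exact: normcDle.
    by apply: normcDle; apply: normcMle.
have -> : lam * (lam * (l * th + th * l) + (D * (th + th) + 2 * lam * (l + l))) +
    lam ^+ 2 * (l + l + (l * th + th * l)) =
    lam * D * th * (26 + 16 * th).
  by rewrite /l; field; rewrite gt_eqF.
have w0 : 0 <= lam * D * th by rewrite !mulr_ge0// ltW.
have -> : 40 * th * lam * D = lam * D * th * 40 by ring.
by rewrite ler_wpM2l//; have := th1; lra.
Qed.

(** First [|z| <= 2 lam], since [z ^+ 2] dominates the error beyond. Then
    [|z - lam| |z + lam| <= 7 th lam^2], where [7 = 2 * 2 + 3]; the two factors add up to at least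
    [2 lam], so one is at least [lam] and the other is small. *)
Lemma secular_root z : lam / 2 <= normc z -> secular z = 0 ->
  normc (z - lam%:C) <= 7 * th * lam \/ normc (z + lam%:C) <= 7 * th * lam.
Proof.
have lam_gt0 := lam0; have th_ge0 := th0; have th_le := th1.
move=> zl z0; have := secular_close zl; rewrite z0 sub0r normcN.
have zu : normc z <= 2 * lam.
  have := secular_close zl; rewrite z0 sub0r normcN => h.
  have := normcB_ge (z ^+ 2) (lam%:C ^+ 2); rewrite !normcX normcR gtr0_norm// => h'.
  rewrite leNgt; apply/negP => zg.
  have k1 : normc z ^+ 2 <= lam ^+ 2 + lam * (2 * th * normc z + 3 * th * lam) by lra.
  have k2 : lam * (2 * th * normc z + 3 * th * lam) <= lam * (normc z / 50 + 3 / 100 * lam).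
    rewrite ler_wpM2l ?(ltW lam0)// lerD//; last by rewrite ler_wpM2r ?(ltW lam0)//; lra.
    by rewrite mulrC ler_wpM2l ?normc_ge0//; lra.
  by nra.
move=> h; have {}h : normc (z - lam%:C) * normc (z + lam%:C) <= 7 * th * lam * lam.
  rewrite -normcM (_ : _ * _ = z ^+ 2 - lam%:C ^+ 2); last by ring.
  apply: (le_trans h).
  have -> : 7 * th * lam * lam = lam * (2 * th * (2 * lam) + 3 * th * lam) by ring.
  by rewrite ler_wpM2l ?(ltW lam0)// lerD2r ler_wpM2l// mulr_ge0.
have big : 2 * lam <= normc (z - lam%:C) + normc (z + lam%:C).
  have : normc ((z + lam%:C) - (z - lam%:C)) <= normc (z + lam%:C) + normc (z - lam%:C).
    by apply: normcBle.
  rewrite (_ : _ - _ = (2 * lam)%:C); last by rewrite rmorphM /= rmorph_nat; ring.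
  by rewrite normcR ger0_norm ?mulr_ge0 ?(ltW lam0)//; lra.
have [h1|h1] := leP (normc (z - lam%:C)) (7 * th * lam); first by left.
right; have n1 := normc_ge0 (z - lam%:C); have n2 := normc_ge0 (z + lam%:C).
have [h2|h2] := leP lam (normc (z - lam%:C)).
  rewrite -(ler_pM2r lam0); apply: le_trans h.
  by rewrite mulrC ler_wpM2r.
have : 7 * th * lam * lam < normc (z - lam%:C) * normc (z + lam%:C).
  have e0 : 0 <= 7 * th * lam by rewrite !mulr_ge0// ltW.
  by nra.
lra.
Qed.

(** The main term is [|z - z'| |z + z'|] with [|z + z'| >= 3/2 lam], and the perturbation removes at
    most [lam / 2 * |z - z'|]. The larger radius for [z'] leaves room to move away from a root
    [z]. *)
Lemma secular_separation (e : R) z z' :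
  e = 1 \/ e = -1 ->
  normc (z - (e * lam)%:C) <= lam / 10 -> normc (z' - (e * lam)%:C) <= lam / 5 ->
  lam * normc (z - z') <= normc (secular z - secular z').
Proof.
have lam_gt0 := lam0; have th_ge0 := th0; have th_le := th1.
move=> e1 zl zl'.
have ne : normc (e * lam)%:C = lam.
  by rewrite normcR normrM (gtr0_norm lam0); case: e1 => ->; rewrite ?normrN normr1 mul1r.
have ba w : normc (w - (e * lam)%:C) <= lam / 5 -> lam / 2 <= normc w <= 2 * lam.
  move=> wl; have := normc_sub_ge (e * lam)%:C w; rewrite ne => h1.
  have := normcDle wl (lexx (normc (e * lam)%:C)); rewrite subrK ne => h2.
  apply/andP; split; lra.
have /andP[za zb] : lam / 2 <= normc z <= 2 * lam by apply: ba; lra.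
have /andP[za' zb'] := ba _ zl'.
have h := secular_lipschitz za za' zb'.
have : normc (z ^+ 2 - z' ^+ 2) - normc (secular z - secular z')
   <= normc (secular z - secular z' - (z ^+ 2 - z' ^+ 2)).
  by rewrite -[X in _ <= normc X]opprB normcN normcB_ge.
have -> : normc (z ^+ 2 - z' ^+ 2) = normc (z - z') * normc (z + z').
  by rewrite -normcM; congr (normc _); ring.
move=> h'.
have s : 3 / 2 * lam <= normc (z + z').
  have h2 := normc_sub_ge (2 * (e * lam))%:C (z + z').
  have h3 : normc (z + z' - (2 * (e * lam))%:C) <= lam / 10 + lam / 5.
    rewrite (_ : _ - _ = (z - (e * lam)%:C) + (z' - (e * lam)%:C)).
      exact: normcDle.
    by rewrite rmorphM /= rmorph_nat; ring.
  have h4 : normc (2 * (e * lam))%:C = 2 * lam.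
    by rewrite (normcR (2 * (e * lam))) normrM -(normcR (e * lam)) ne ger0_norm.
  lra.
have D0 := normc_ge0 (z - z').
have a1 : normc (z - z') * (3 / 2 * lam) <= normc (z - z') * normc (z + z').
  by rewrite ler_wpM2l.
have a2 : 40 * th * lam * normc (z - z') <= lam / 2 * normc (z - z').
  by rewrite ler_wpM2r// [leRHS]mulrC ler_pM2r//; lra.
lra.
Qed.

(** Here [p] stands for the perturbed characteristic polynomial and [q] for that of the noise.
    Distinct [z1], [z2] contradict the separation of zeros; a repeated root needs a separate
    argument. *)
Lemma secular_simple (p q g : {poly R[i]}) (e : R) z1 z2 :
  e = 1 \/ e = -1 ->
  (forall z, lam / 2 <= normc z -> q.[z] != 0) ->
  (forall z, lam / 2 <= normc z -> p.[z] * z ^+ 2 = q.[z] * secular z) ->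
  p = ('X - z1%:P) * (('X - z2%:P) * g) ->
  normc (z1 - (e * lam)%:C) <= lam / 10 ->
  normc (z2 - (e * lam)%:C) <= lam / 10 -> False.
Proof.
have lam_gt0 := lam0; have th_ge0 := th0; have th_le := th1.
move=> e1 qn0 pq pE n1 n2.
have near_big w : normc (w - (e * lam)%:C) <= lam / 5 -> lam / 2 <= normc w.
  move=> wl; have := normc_sub_ge (e * lam)%:C w.
  have -> : normc (e * lam)%:C = lam.
    by rewrite normcR normrM (gtr0_norm lam0); case: e1 => ->; rewrite ?normrN normr1 mul1r.
  lra.
have b1 : lam / 2 <= normc z1 by apply: near_big; lra.
have b2 : lam / 2 <= normc z2 by apply: near_big; lra.
have s1 : secular z1 = 0.
  have := pq _ b1; rewrite pE hornerM hornerXsubC subrr !mul0r => /esym/eqP.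
  by rewrite mulf_eq0 (negbTE (qn0 _ b1)) => /eqP.
have s2 : secular z2 = 0.
  have := pq _ b2; rewrite pE !hornerM !hornerXsubC subrr mul0r mulr0 mul0r => /esym/eqP.
  by rewrite mulf_eq0 (negbTE (qn0 _ b2)) => /eqP.
have [z12|z12] := eqVneq z1 z2; last first.
  have := secular_separation e1 n1 (le_trans n2 _); rewrite s1 s2 subr0 normc0.
  have D : 0 < normc (z1 - z2).
    by rewrite lt_neqAle eq_sym normc_eq0 subr_eq0 z12 normc_ge0.
  have h : lam / 10 <= lam / 5 by lra.
  by move=> /(_ h); have := mulr_gt0 lam0 D; lra.
(* Double root: at [z1 + t] the side [p z^2] is of order [t^2], while separation makes the other
   side at least [lam t |q|]. Dividing by [t] and letting it shrink forces [q] to vanish at [z1]. *)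
subst z2.
(* [q'] is the difference quotient of [q] at [z1]; its boundedness on a segment serves as continuity
   of [q]. *)
have [q' q'E] : exists q' : {poly R[i]}, q - (q.[z1])%:P = q' * ('X - z1%:P).
  by apply/factor_theorem; rewrite /root hornerD hornerN hornerC subrr.
have [K1 HK1] := normc_poly_bounded q' z1.
have [K2 HK2] := normc_poly_bounded ('X^2 * g) z1.
have : lam * normc q.[z1] <= 0.
  apply: (@le0_of_small _ _ (lam * K1 + K2) (Num.min 1 (lam / 10))).
    by rewrite lt_min ltr01 divr_gt0.
  move=> t /andP[t0]; rewrite le_min => /andP[t1 tl].
  have nt : normc t%:C = t by rewrite normcR gtr0_norm.
  have t01 : 0 <= t <= 1 by rewrite (ltW t0).
  have n5 : normc (z1 + t%:C - (e * lam)%:C) <= lam / 5.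
    rewrite addrAC; apply: le_trans (normcDle n1 (lexx (normc t%:C))) _.
    by rewrite nt; lra.
  have := secular_separation e1 n1 n5.
  rewrite s1 sub0r normcN opprD addNKr normcN nt => sep.
  have bt := near_big _ n5; have := pq _ bt.
  rewrite pE !hornerM !hornerXsubC addrAC subrr add0r => E.
  have Ht : t * normc (q.[z1 + t%:C]) * lam <= t ^+ 2 * K2.
    apply: (@le_trans _ _ (normc (q.[z1 + t%:C] * secular (z1 + t%:C)))).
      by rewrite normcM mulrAC mulrC ler_wpM2l ?normc_ge0// mulrC.
    rewrite -E; have := HK2 _ t01; rewrite hornerM hornerXn => k2.
    rewrite (_ : _ * _ = t%:C ^+ 2 * ((z1 + t%:C) ^+ 2 * g.[z1 + t%:C])); last by ring.
    by rewrite normcM normcX nt ler_wpM2l ?sqr_ge0.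
  have Hq : normc q.[z1] - t * K1 <= normc (q.[z1 + t%:C]).
    have := congr1 (fun r : {poly R[i]} => r.[z1 + t%:C]) q'E; rewrite hornerD hornerN hornerC hornerM hornerXsubC addrAC subrr add0r => Eq.
    have := normc_sub_ge q.[z1] q.[z1 + t%:C].
    rewrite Eq normcM nt => h.
    apply: le_trans h; rewrite lerB// mulrC ler_wpM2l ?(ltW t0)// HK1//.
  have {}Ht : normc (q.[z1 + t%:C]) * lam <= t * K2.
    by rewrite -(ler_pM2l t0) mulrA (le_trans Ht)// mulrA expr2.
  have : (normc q.[z1] - t * K1) * lam <= t * K2.
    by apply: le_trans Ht; rewrite ler_wpM2r// ltW.
  lra.
rewrite pmulr_rle0// le_eqVlt ltNge normc_ge0 orbF normc_eq0.
by rewrite (negbTE (qn0 _ b1)).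
Qed.

End PerturbedEquation.

Lemma det_block_mx11 (R : comPzRingType) (A B C D : 'M[R]_1) :
  \det (block_mx A B C D) = A 0 0 * D 0 0 - B 0 0 * C 0 0.
Proof.
rewrite (det_mx2 (block_mx A B C D : 'M[R]_2)).
have e0 : (0 : 'I_2) = lshift 1 (0 : 'I_1) by apply: val_inj.
have e1 : (1 : 'I_2) = rshift 1 (0 : 'I_1) by apply: val_inj.
by rewrite e0 e1 -(block_mxEul A B C D) -(block_mxEdr A B C D) -(block_mxEur A B C D)
  -(block_mxEdl A B C D).
Qed.

(** * Leading eigenvalues of a rank-two perturbation *)

Section RankTwoPerturbation.
Variables (R : realType) (n : nat) (H : 'M[R]_n) (a b : 'cV[R]_n).
Variables (lam eps rho : R).
Hypotheses (lam0 : 0 < lam) (eps0 : 0 <= eps) (eps2 : eps <= 2)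
  (rho0 : 0 <= rho) (rho_lam : 800 * rho <= lam)
  (Hpow : forall k i j, `|(H ^+ k) i j| <= rho ^+ k)
  (aa : (a^T *m a) 0 0 = 1) (bb : (b^T *m b) 0 0 = 1) (ab : (a^T *m b) 0 0 = 0)
  (Hform : forall x y, x \in [:: a; b] -> y \in [:: a; b] ->
     forall k, (0 < k)%N -> `|form H x y k| <= eps * rho ^+ k).
Local Notation toC := (map_mx (real_complex R)).

Let M := H + lam *: (a *m b^T + b *m a^T).
Let F := secular lam (phi H b a) (phi H a b) (phi H a a) (phi H b b).
Let th := 4 * eps * rho / lam.

(** Origin of [800 = 100 * 4 * 2]: the required [100 * th <= 1], the [4] in [th], and [eps <= 2]. *)
Lemma th_bounds : 0 <= th /\ 100 * th <= 1.
Proof.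
have l0 := lam0; have r0 := rho0; have e0 := eps0; have e2 := eps2; have rl := rho_lam.
split; first by rewrite /th !mulr_ge0 ?invr_ge0 ?(ltW lam0).
rewrite /th mulrA ler_pdivrMr// mul1r; nra.
Qed.

Lemma large_resolvent z : lam / 2 <= normc z -> 2 * rho <= normc z /\ 0 < normc z.
Proof.
have l0 := lam0; have r0 := rho0; have rl := rho_lam.
by move=> zl; split; lra.
Qed.

Lemma small_lipschitz_phi x y : x \in [:: a; b] -> y \in [:: a; b] ->
  small_lipschitz lam th (phi H x y).
Proof.
move=> xab yab; have l0 := lam0; have f := Hform xab yab.
have inv z : lam / 2 <= normc z -> (normc z)^-1 <= 2 / lam.
  move=> zl; rewrite -[2 / lam]invrK invf_div lef_pV2 ?posrE ?divr_gt0//.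
  by apply: lt_le_trans zl; rewrite divr_gt0.
split => [z zl|z z' zl zl'].
  have [rz z0] := large_resolvent zl.
  apply: le_trans (phi_le rho0 Hpow eps0 f rz z0) _.
  apply: (@le_trans _ _ (2 * eps * rho * (2 / lam))).
    by rewrite ler_wpM2l ?inv// !mulr_ge0 ?eps0.
  by rewrite /th le_eqVlt; apply/orP; left; apply/eqP; ring.
have [rz z0] := large_resolvent zl; have [rz' z0'] := large_resolvent zl'.
apply: le_trans (phi_lipschitz rho0 Hpow eps0 f rz z0 rz' z0') _.
have zn : z != 0 by rewrite -normc_eq0 gt_eqF.
have zn' : z' != 0 by rewrite -normc_eq0 gt_eqF.
have -> : z^-1 - z'^-1 = (z' - z) * (z^-1 * z'^-1) by field; rewrite zn zn'.
rewrite !normcM !normcV -[normc (z' - z)]normcN opprB.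
have -> : 4 * th / lam * normc (z - z') =
   4 * eps * rho * (normc (z - z') * (2 / lam * (2 / lam))).
  by rewrite /th; field; rewrite gt_eqF.
rewrite ler_wpM2l ?mulr_ge0 ?eps0// ler_wpM2l ?normc_ge0//.
by rewrite ler_pM ?inv ?invr_ge0 ?normc_ge0.
Qed.

Lemma form0 x y : form H x y 0 = (x^T *m y) 0 0.
Proof. by rewrite /form expr0 mulmx1. Qed.

Lemma char_poly_secular z : lam / 2 <= normc z ->
  (char_poly (toC H)).[z] != 0 /\
  (char_poly (toC M)).[z] * z ^+ 2 = (char_poly (toC H)).[z] * F z.
Proof.
move=> zl; have [rz z0] := large_resolvent zl.
have uz := resolvent_unit rho0 Hpow rz z0.
have zn : z != 0 by rewrite -normc_eq0 gt_eqF.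
rewrite !horner_char_poly; split; first by rewrite -unitfE -unitmxE.
(* [U *m W] is the rank-two part. Listing [b] before [a] in [W] puts the cross terms [b^T G a] and
   [a^T G b] on the diagonal, next to the [1]. *)
pose U := row_mx (toC a) (toC b).
pose W := col_mx (lam%:C *: (toC b)^T) (lam%:C *: (toC a)^T).
have -> : z%:M - toC M = (z%:M - toC H) - U *m W.
  rewrite /M /W /U map_mxD map_mxZ map_mxD !map_mxM !matrix.map_trmx opprD addrA.
  by rewrite mul_row_col -!scalemxAr -scalerDr.
rewrite det_subM// -mulrA; congr (_ * _).
set G := invmx _.
have -> : 1%:M - W *m G *m U =
   block_mx (1%:M - lam%:C *: ((toC b)^T *m G *m toC a))
            (- (lam%:C *: ((toC b)^T *m G *m toC b)))
            (- (lam%:C *: ((toC a)^T *m G *m toC a)))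
            (1%:M - lam%:C *: ((toC a)^T *m G *m toC b)).
  rewrite /W /U mul_col_mx mul_col_row -!scalemxAl scalar_mx_block.
  by rewrite opp_block_mx add_block_mx !sub0r.
have oneB (X : 'M[R[i]]_1) : (1%:M - lam%:C *: X) 0 0 = 1 - lam%:C * X 0 0 by rewrite !mxE.
have oppZ (X : 'M[R[i]]_1) : (- (lam%:C *: X)) 0 0 = - (lam%:C * X 0 0) by rewrite !mxE.
rewrite det_block_mx11 (oneB (_ *m toC a)) (oneB (_ *m toC b)).
rewrite (oppZ (_ *m toC b)) (oppZ (_ *m toC a)).
have ba : (b^T *m a) 0 0 = 0.
  transitivity ((a^T *m b)^T 0 0); last by rewrite mxE.
  by rewrite trmx_mul trmxK.
rewrite /F /secular /phi -/G !form0 aa bb ab ba.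
set X1 := (_ *m toC a) 0 0; set X2 := (_ *m toC b) 0 0.
rewrite /= !subr0; ring.
Qed.

(** On the real axis [F] is [p x^2 / q] with real polynomials. The intermediate value theorem is
    applied to the polynomial [q * p], which has the sign of [F]; as [q] does not vanish there, the
    zero belongs to [p]. The substitution [e *: 'X] treats both signs at once. *)
Lemma real_root (e : R) : e = 1 \/ e = -1 ->
  exists r : R, [/\ 0 < e * r, lam / 2 <= normc r%:C & root (char_poly (toC M)) r%:C].
Proof.
move=> he; have l0 := lam0; have [t0 t1] := th_bounds.
have sl x y := @small_lipschitz_phi x y.
have close := secular_close lam0 t0 t1 (sl b a _ _) (sl a b _ _) (sl a a _ _) (sl b b _ _).
have {}close z : lam / 2 <= normc z ->
    normc (F z - (z ^+ 2 - lam%:C ^+ 2)) <= lam * (2 * th * normc z + 3 * th * lam).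
  by apply: close; rewrite !inE eqxx ?orbT.
pose p := char_poly M; pose q := char_poly H.
have cpE (A : 'M[R]_n) (x : R) : (char_poly (toC A)).[x%:C] = ((char_poly A).[x])%:C.
  by rewrite -map_char_poly horner_map.
have ee : e ^+ 2 = 1 by case: he => ->; rewrite ?sqrrN expr1n.
have nex (x : R) : 0 <= x -> normc (e * x)%:C = x.
  by move=> x0; rewrite normcR normrM (ger0_norm x0); case: he => ->; rewrite ?normrN normr1 mul1r.
have val x : lam / 2 <= x -> q.[e * x] != 0 /\
   `|p.[e * x] * x ^+ 2 / q.[e * x] - (x ^+ 2 - lam ^+ 2)| <=
     lam * (2 * th * x + 3 * th * lam).
  move=> xl; have x0 : 0 <= x by lra.
  have zl : lam / 2 <= normc (e * x)%:C by rewrite nex.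
  have [qn0 E] := char_poly_secular zl.
  rewrite !cpE -/p -/q in qn0 E.
  have qn : q.[e * x] != 0 by apply: contra qn0 => /eqP ->.
  split=> //; have := close _ zl; rewrite nex//.
  have FE : F (e * x)%:C = (p.[e * x] * x ^+ 2 / q.[e * x])%:C.
    apply: (mulfI qn0); rewrite -E -!rmorphXn -!rmorphM /=; congr (_%:C).
    by rewrite exprMn ee; field.
  by rewrite FE -!rmorphXn -!rmorphB exprMn ee mul1r normcR.
have sgn x : lam / 2 <= x -> q.[e * x] != 0 /\
   (q * p).[e * x] = (q.[e * x]) ^+ 2 * x ^- 2 * (p.[e * x] * x ^+ 2 / q.[e * x]).
  move=> xl; have [qn _] := val x xl; split => //.
  have xn : x != 0 by rewrite gt_eqF//; lra.
  by rewrite hornerM; field; rewrite xn qn.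
have lo : lam / 2 <= lam / 2 by [].
have hi : lam / 2 <= 3 / 2 * lam by lra.
have [qlo slo] := sgn _ lo; have [_ vlo] := val _ lo.
have [qhi shi] := sgn _ hi; have [_ vhi] := val _ hi.
have pos x : lam / 2 <= x -> q.[e * x] != 0 -> 0 < q.[e * x] ^+ 2 * x ^- 2.
  move=> xl qn; rewrite mulr_gt0 ?exprn_even_gt0//= ?invr_gt0 ?exprn_gt0//; lra.
(* At [lam / 2] the main term is [-3/4 lam^2] and the error at most [4 th lam^2]; at [3/2 lam] they
   are [5/4 lam^2] and [6 th lam^2]. The bound [100 th <= 1] makes both signs certain. *)
have nlo : (q * p).[e * (lam / 2)] < 0.
  rewrite slo (pmulr_rlt0 _ (pos _ lo qlo)).
  set v := _ / q.[_] in vlo *.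
  have := ler_norm (v - ((lam / 2) ^+ 2 - lam ^+ 2)).
  have l2 : 0 < lam * lam by rewrite mulr_gt0.
  have l3 : 100 * (th * (lam * lam)) <= lam * lam.
    by rewrite mulrA -[leRHS]mul1r ler_wpM2r// ltW.
  have l4 : 0 <= th * (lam * lam) by rewrite mulr_ge0// ltW.
  have -> : (lam / 2) ^+ 2 - lam ^+ 2 = - (3 / 4) * (lam * lam) by field.
  have : lam * (2 * th * (lam / 2) + 3 * th * lam) = 4 * (th * (lam * lam)) by field.
  move: vlo; have -> : (lam / 2) ^+ 2 - lam ^+ 2 = - (3 / 4) * (lam * lam) by field.
  lra.
have phi0 : 0 < (q * p).[e * (3 / 2 * lam)].
  rewrite shi (pmulr_rgt0 _ (pos _ hi qhi)).
  set v := _ / q.[_] in vhi *.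
  have := ler_norm (- (v - ((3 / 2 * lam) ^+ 2 - lam ^+ 2))); rewrite normrN.
  have l2 : 0 < lam * lam by rewrite mulr_gt0.
  have l3 : 100 * (th * (lam * lam)) <= lam * lam.
    by rewrite mulrA -[leRHS]mul1r ler_wpM2r// ltW.
  have l4 : 0 <= th * (lam * lam) by rewrite mulr_ge0// ltW.
  have : lam * (2 * th * (3 / 2 * lam) + 3 * th * lam) = 6 * (th * (lam * lam)) by field.
  move: vhi; have -> : (3 / 2 * lam) ^+ 2 - lam ^+ 2 = 5 / 4 * (lam * lam) by field.
  lra.
have le : lam / 2 <= 3 / 2 * lam by lra.
pose P := (q * p) \Po (e *: 'X).
have PE x : P.[x] = (q * p).[e * x] by rewrite /P horner_comp hornerZ hornerX.
have sP : P.[lam / 2] <= 0 <= P.[3 / 2 * lam] by rewrite !PE (ltW nlo) (ltW phi0).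
have [x] := poly_ivt le sP.
move=> /andP[x1 x2]; rewrite /root PE hornerM mulf_eq0.
have [qn _] := sgn _ x1; rewrite (negbTE qn) /= => px.
have x0 : 0 <= x by lra.
exists (e * x); split.
- by rewrite mulrA -expr2 ee mul1r; lra.
- by apply: (le_trans x1); have := nex x x0 => {1}<-.
- by rewrite /root cpE (eqP px).
Qed.

(** Each of [l1], [l2] is near [lam] or [-lam]. Both near the same point contradicts simplicity, and
    the swapped position contradicts the order of the real parts. The [28] is [7 * 4]. *)
Lemma leading_eigenvalues_close (l1 l2 : R[i]) :
  leading_eigenvalues M l1 l2 ->
  Num.max (normc (l1 - lam%:C)) (normc (l2 + lam%:C)) <= 28 * eps * rho.
Proof.
case=> -[s [pE smax]] Rel; have l0 := lam0; have [t0 t1] := th_bounds.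
have thl : 7 * th * lam = 28 * eps * rho by rewrite /th; field; rewrite gt_eqF.
have tl : 7 * th * lam <= lam / 10.
  by rewrite [leRHS]mulrC ler_wpM2r ?(ltW lam0)//; lra.
have [r1 [r1p r1l r1root]] := real_root (or_introl erefl : (1 : R) = 1 \/ (1 : R) = -1).
have [r2 [r2p r2l r2root]] := real_root (or_intror erefl : (-1 : R) = 1 \/ (-1 : R) = -1).
have mem z : root (char_poly (toC M)) z -> z \in [:: l1, l2 & s].
  by rewrite pE root_prod_XsubC.
have m1 := mem _ r1root; have m2 := mem _ r2root.
have r12 : r1%:C != r2%:C :> R[i].
  apply/negP => /eqP/complexI e; rewrite e in r1p.
  have : (0 : R) < 0 by lra.
  by rewrite ltxx.
(* Either the two real roots are [l1] and [l2] themselves, or one of them is in [s], and then [l1]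
   and [l2] both have at least its modulus. *)
have big12 : lam / 2 <= normc l1 /\ lam / 2 <= normc l2.
  have sbig z : z \in s -> lam / 2 <= normc z -> lam / 2 <= normc l1 /\ lam / 2 <= normc l2.
    by move=> zs zl; have [h1 h2] := smax _ zs; split; exact: le_trans zl _.
  move: m1; rewrite !inE => /or3P[/eqP e1|/eqP e1|/sbig]; last exact.
    move: m2; rewrite !inE => /or3P[/eqP e2|/eqP e2|/sbig]; last exact.
      by rewrite e1 -e2 eqxx in r12.
    by rewrite -e1 -e2.
  move: m2; rewrite !inE => /or3P[/eqP e2|/eqP e2|/sbig]; last exact.
    by rewrite -e1 -e2.
  by rewrite e1 -e2 eqxx in r12.
have [b1 b2] := big12.
have sl x y := @small_lipschitz_phi x y.
have rootF z : z \in [:: l1; l2] -> lam / 2 <= normc z -> F z = 0.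
  move=> zs zl; have [qn0 E] := char_poly_secular zl.
  have : root (char_poly (toC M)) z.
    rewrite pE root_prod_XsubC; move: zs; rewrite !inE.
    by case/orP => ->; rewrite ?orbT.
  move=> /eqP pz; move: E; rewrite pz mul0r => /esym/eqP.
  by rewrite mulf_eq0 (negbTE qn0) => /eqP.
have near z : z \in [:: l1; l2] -> lam / 2 <= normc z ->
    normc (z - lam%:C) <= 7 * th * lam \/ normc (z + lam%:C) <= 7 * th * lam.
  move=> zs zl.
  by apply: (secular_root lam0 t0 t1 (sl b a _ _) (sl a b _ _) (sl a a _ _) (sl b b _ _));
    rewrite ?inE ?eqxx ?orbT//; apply: rootF.
have simple e : e = 1 \/ e = -1 ->
    normc (l1 - (e * lam)%:C) <= lam / 10 -> normc (l2 - (e * lam)%:C) <= lam / 10 -> False.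
  move=> he.
  apply: (@secular_simple _ _ _ _ _ _ _ lam0 t0 t1 (sl b a _ _) (sl a b _ _) (sl a a _ _) (sl b b _ _)
     (char_poly (toC M)) (char_poly (toC H)) (\prod_(z <- s) ('X - z%:P)) e l1 l2 he);
    rewrite ?inE ?eqxx ?orbT//.
  - by move=> z /char_poly_secular[].
  - by move=> z /char_poly_secular[_].
  - by rewrite pE !big_cons.
have e1 : (1 * lam)%:C = lam%:C :> R[i] by rewrite mul1r.
have eN1 : (-1 * lam)%:C = - lam%:C :> R[i] by rewrite mulN1r rmorphN.
have n1 : l1 \in [:: l1; l2] by rewrite inE eqxx.
have n2 : l2 \in [:: l1; l2] by rewrite !inE eqxx orbT.
rewrite ge_max -thl.
case: (near _ n1 b1) => h1; case: (near _ n2 b2) => h2.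
- by case: (simple 1); rewrite ?e1 ?(le_trans h1) ?(le_trans h2)//; left.
- by rewrite h1 h2.
- exfalso.
  have g1 := le_trans (normc_ge_Re _) h1; have g2 := le_trans (normc_ge_Re _) h2.
  move: g1 g2; rewrite !raddfD /= ?raddfN /= => g1 g2.
  have g3 := ler_norm (complex.Re l1 + lam); have := ler_norm (- (complex.Re l2 - lam)).
  rewrite normrN => g4; have : (0 : R) < 0 by lra.
  by rewrite ltxx.
- by case: (simple (-1)); rewrite ?eN1 ?opprK ?(le_trans h1) ?(le_trans h2)//; right.
Qed.

End RankTwoPerturbation.

(** * Moments of bilinear forms in matrix powers *)

Definition fcons (V : finType) k (v : V) (w : {ffun 'I_k -> V}) :
    {ffun 'I_k.+1 -> V} :=
  [ffun i => oapp w v (unlift ord0 i)].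

Lemma fcons0 (V : finType) k (v : V) (w : {ffun 'I_k -> V}) :
  fcons v w ord0 = v.
Proof. by rewrite ffunE unlift_none. Qed.

Lemma fconsS (V : finType) k (v : V) (w : {ffun 'I_k -> V}) j :
  fcons v w (lift ord0 j) = w j.
Proof. by rewrite ffunE liftK. Qed.

Lemma sum_fcons (R : nmodType) (V : finType) k (F : {ffun 'I_k.+1 -> V} -> R) :
  \sum_w F w = \sum_v \sum_w F (fcons v w).
Proof.
rewrite pair_big /= (reindex (fun p : V * {ffun 'I_k -> V} => fcons p.1 p.2)) //=.
exists (fun w => (w ord0, [ffun j => w (lift ord0 j)])).
- move=> [v w] _ /=; rewrite fcons0; congr pair.
  by apply/ffunP => j; rewrite ffunE fconsS.
- move=> w _ /=; apply/ffunP => i; rewrite ffunE.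
  by case: unliftP => [j ->|->] //=; rewrite ffunE.
Qed.

Definition walk_prod (R : comPzRingType) (V : finType) (h : V -> V -> R) k
    (w : {ffun 'I_k.+1 -> V}) : R :=
  \prod_(t < k) h (w (widen_ord (leqnSn k) t)) (w (lift ord0 t)).

(** Induction with [x] generalized: the first step of the walk is absorbed into the vector, which
    becomes [h^T *m x]. *)
Lemma bilinear_walk_sum (R : comPzRingType) n (h : 'M[R]_n) (y : 'cV[R]_n) k
    (x : 'cV[R]_n) :
  (x^T *m h ^+ k *m y) 0 0 =
  \sum_(w : {ffun 'I_k.+1 -> 'I_n})
     x (w ord0) 0 * walk_prod h w * y (w ord_max) 0.
Proof.
elim: k x => [|k IH] x.
  rewrite expr0 mulmx1 mxE sum_fcons; apply: eq_bigr => v _.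
  rewrite (bigD1 [ffun=> v]) //= big1 ?addr0 => [|w].
    rewrite mxE /walk_prod big_ord0 mulr1 fcons0; congr (_ * y _ 0).
    by rewrite (_ : ord_max = ord0) ?fcons0 //; apply: val_inj.
  by case/negP; apply/eqP/ffunP; case.
have -> : x^T *m h ^+ k.+1 = (h^T *m x)^T *m h ^+ k.
  rewrite exprS trmx_mul trmxK; exact: mulmxA.
rewrite IH [RHS]sum_fcons exchange_big /=; apply: eq_bigr => w _.
rewrite mxE 2!mulr_suml; apply: eq_bigr => v _.
rewrite mxE /walk_prod big_ord_recl.
have -> : widen_ord (leqnSn k.+1) ord0 = ord0 by apply: val_inj.
rewrite fcons0 fconsS.
have -> : (ord_max : 'I_k.+2) = lift ord0 ord_max by apply: val_inj.
rewrite fconsS [h v _ * x v 0]mulrC !mulrA; congr (_ * _ * _).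
apply: eq_bigr => t _.
have -> : widen_ord (leqnSn k.+1) (lift ord0 t) = lift ord0 (widen_ord (leqnSn k) t).
  by apply: val_inj.
by rewrite !fconsS.
Qed.

(** * Families of walks sorted by coincidence pattern *)

Section WalkPatterns.
Variables (V : finType) (q k : nat).
Local Notation step := ('I_q * 'I_k.+1)%type.
Local Notation walks := {ffun 'I_q -> {ffun 'I_k.+2 -> V}}.

(** Walks have [k.+1] steps and [k.+2] vertices, so that each of them has a first step [ord0]. *)
Definition step_edge (W : walks) (s : step) : V * V :=
  (W s.1 (widen_ord (leqnSn _) s.2), W s.1 (lift ord0 s.2)).

(** The partition of the steps by directed edge, encoded as a map to a chosen representative: its
    fixed points count the edges, and a sum over patterns extends to a sum over all maps. The
    default [s] is never reached, since [s] itself qualifies. *)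
Definition pattern (W : walks) : {ffun step -> step} :=
  [ffun s => odflt s [pick s' | step_edge W s' == step_edge W s]].

Definition paired (W : walks) : bool :=
  [forall s, exists s', (s' != s) && (step_edge W s' == step_edge W s)].

Lemma pattern_edge W s : step_edge W (pattern W s) = step_edge W s.
Proof. by rewrite ffunE; case: pickP => [s' /eqP|]. Qed.

Lemma edge_pattern W s s' :
  step_edge W s = step_edge W s' -> pattern W s = pattern W s'.
Proof.
move=> e; rewrite !ffunE e; case: pickP => //= none.
by have := none s'; rewrite eqxx.
Qed.

Lemma pattern_idem W s : pattern W (pattern W s) = pattern W s.
Proof. exact/edge_pattern/pattern_edge. Qed.

Lemma card_pattern W :
  #|[set s | pattern W s == s]| = #|[set step_edge W s | s in setT]|.
Proof.
rewrite -(card_in_imset (f := step_edge W)).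
  apply: eq_card => e; apply/imsetP/imsetP => -[s _ ->].
    by exists s; rewrite ?inE.
  by exists (pattern W s); rewrite ?inE ?pattern_idem // pattern_edge.
by move=> s s' /[!inE] /eqP <- /eqP <- /edge_pattern; rewrite !pattern_idem.
Qed.

Variable R : realType.
Implicit Types (x : V -> R).

(* For a given pattern, the walks are determined by the heads of the fixed
   points and by the starting points of the initial classes: in any other class
   the common tail is the head of some step.  When all classes have two
   elements, each starting point left free thus carries a weight [x v ^+ 2],
   whose sum is at most 1. *)
Definition initial (P : {ffun step -> step}) (r : 'I_q) : bool :=
  [forall s : step, (P s == P (r, ord0)) ==> (s.2 == ord0)].

Definition free_start P r := initial P r && (P (r, ord0) == (r, ord0)).

Lemma pattern_code_inj (P : {ffun step -> step}) (W W' : walks) :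
  pattern W = P -> pattern W' = P ->
  (forall s, P s == s -> W s.1 (lift ord0 s.2) = W' s.1 (lift ord0 s.2)) ->
  (forall r, free_start P r -> W r ord0 = W' r ord0) ->
  W = W'.
Proof.
move=> PW PW' Hh Hs.
have head s : W s.1 (lift ord0 s.2) = W' s.1 (lift ord0 s.2).
  have /(congr1 snd)/= <- := pattern_edge W s.
  have /(congr1 snd)/= <- := pattern_edge W' s.
  by rewrite PW PW'; apply: Hh; rewrite -PW pattern_idem.
have tl s s' : P s = P s' ->
   W s.1 (widen_ord (leqnSn _) s.2) = W s'.1 (widen_ord (leqnSn _) s'.2) /\
   W' s.1 (widen_ord (leqnSn _) s.2) = W' s'.1 (widen_ord (leqnSn _) s'.2).
  move=> e; split.
    have /(congr1 fst)/= <- := pattern_edge W s.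
    by have /(congr1 fst)/= <- := pattern_edge W s'; rewrite PW e.
  have /(congr1 fst)/= <- := pattern_edge W' s.
  by have /(congr1 fst)/= <- := pattern_edge W' s'; rewrite PW' e.
have w0 : widen_ord (leqnSn k.+1) ord0 = ord0 by apply: val_inj.
apply/ffunP => r; apply/ffunP => i.
case: (unliftP ord0 i) => [j ->|->]; first exact: (head (r, j)).
(* In an initial class the representative is again a first step, and the walk it begins has a free
   start, at the same vertex. *)
have [ini|] := boolP (initial P r).
  have e : P (P (r, ord0)) = P (r, ord0) by rewrite -PW pattern_idem.
  move/forallP: (ini) => /(_ (P (r, ord0))); rewrite e eqxx /= => /eqP e2.
  have [/=] := tl _ _ e; rewrite e2 w0 => <- <-.
  have ep : ((P (r, ord0)).1, ord0) = P (r, ord0).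
    by move: e2; case: (P _) => p1 p2 /= ->.
  apply: Hs; rewrite /free_start ep e eqxx andbT /initial ep e.
  exact: ini.
(* Otherwise the class contains a step that is not the first of its walk, and the tail of that step
   is the head of the one before it. *)
rewrite negb_forall => /existsP[s]; rewrite negb_imply => /andP[/eqP e s2].
have [/=] := tl _ _ e; rewrite w0 => <- <-.
case: (unliftP ord0 s.2) s2 => [j ->|->]; last by rewrite eqxx.
move=> _.
have -> : widen_ord (leqnSn k.+1) (lift ord0 j) =
          lift ord0 (widen_ord (leqnSn k) j) by apply: val_inj.
exact: (head (s.1, widen_ord (leqnSn k) j)).
Qed.

(** The first step of a walk with free start is paired with another step of its class, which is
    initial, so that step begins a different walk at the same vertex. These mates are pairwise
    distinct and not free, so each supplies the second factor of a square; the remaining factors are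
    at most [1]. *)
Lemma paired_start_le x (P : {ffun step -> step}) (W : walks) :
  (forall v, 0 <= x v <= 1) -> paired W -> pattern W = P ->
  \prod_r x (W r ord0) <= \prod_(r | free_start P r) x (W r ord0) ^+ 2.
Proof.
move=> x01 gW PW.
have w0 : widen_ord (leqnSn k.+1) ord0 = ord0 by apply: val_inj.
have mateP r : free_start P r -> exists r', [&& r' != r, initial P r' &
    P (r', ord0) == (r, ord0)].
  case/andP => /forallP ini /eqP fx.
  have /forallP/(_ (r, ord0))/existsP[s /andP[sr /eqP es]] := gW.
  have := edge_pattern es; rewrite PW fx => Ps.
  have := ini s; rewrite Ps fx eqxx /= => /eqP s2.
  exists s.1; have es1 : (s.1, ord0) = s by rewrite -s2 -surjective_pairing.
  apply/and3P; split; last by rewrite es1 Ps.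
    by apply: contraNneq sr => s1r; rewrite -es1 s1r.
  apply/forallP => s'; rewrite es1 Ps -fx; exact: ini.
pose mate r := odflt r [pick r' | [&& r' != r, initial P r' &
    P (r', ord0) == (r, ord0)]].
have mateE r : free_start P r ->
    [&& mate r != r, initial P (mate r) & P (mate r, ord0) == (r, ord0)].
  move=> /mateP[r' Hr']; rewrite /mate; case: pickP => //= /(_ r').
  by rewrite Hr'.
have injm : {in [set r | free_start P r] &, injective mate}.
  move=> r r' /[!inE] /mateE/and3P[_ _ /eqP e] /mateE/and3P[_ _ /eqP e'] em.
  by move: e; rewrite em e' => -[].
have disj : [disjoint [set r | free_start P r] & mate @: [set r | free_start P r]].
  apply/pred0P => r /=; apply/negbTE/negP => /andP[] /[!inE] fr /imsetP[r'] /[!inE] fr' e.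
  have /and3P[ne _ /eqP] := mateE _ fr'; rewrite -e.
  by case/andP: fr => _ /eqP -> -[] rr'; move: ne; rewrite -e rr' eqxx.
rewrite (bigID (mem [set r | free_start P r])) /=.
under eq_bigl do rewrite inE.
under [leRHS]eq_bigr do rewrite expr2.
rewrite big_split /=; apply: ler_wpM2l.
  by apply: prodr_ge0 => r _; case/andP: (x01 (W r ord0)).
rewrite (bigID (mem (mate @: [set r | free_start P r]))) /=.
rewrite (eq_bigl (mem (mate @: [set r | free_start P r]))); last first.
  move=> r /=; rewrite andb_idl //= => rm; apply/negP => fr.
  by have /pred0P/(_ r)/= := disj; rewrite fr rm.
rewrite big_imset //=.
have -> : \prod_(i in [set r | free_start P r]) x (W (mate i) ord0) =
   \prod_(i | free_start P i) x (W i ord0).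
  apply: eq_big => [r|r]; rewrite ?inE // => fr.
  have /and3P[_ _ /eqP e] := mateE r fr; congr x.
  have := pattern_edge W (mate r, ord0); rewrite PW e => -[/=].
  by rewrite w0 => ->.
rewrite ler_piMr //.
  by apply: prodr_ge0 => r _; case/andP: (x01 (W r ord0)).
by apply: prodr_ile1 => r _; exact: x01.
Qed.

(** Families are coded injectively by their free coordinates, the others being frozen at [v0].
    Extended to all codes, the weight factorizes over coordinates: a free head gives [#|V|], a free
    start at most [1], a frozen coordinate exactly [1]. *)
Lemma pattern_weight_sum x (P : {ffun step -> step}) (v0 : V) :
  (forall v, 0 <= x v <= 1) -> \sum_v x v ^+ 2 <= 1 ->
  \sum_(W | paired W && (pattern W == P)) \prod_r x (W r ord0)
    <= #|V|%:R ^+ #|[set s | P s == s]|.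
Proof.
move=> x01 x2.
pose code (W : walks) : {ffun step -> V} * {ffun 'I_q -> V} :=
  ([ffun s : step => if P s == s then W s.1 (lift ord0 s.2) else v0],
   [ffun r => if free_start P r then W r ord0 else v0]).
pose psi1 (s : step) (v : V) : R := if P s == s then 1 else (v == v0)%:R.
pose psi2 r (v : V) : R := if free_start P r then x v ^+ 2 else (v == v0)%:R.
have psi1_ge0 s v : 0 <= psi1 s v by rewrite /psi1; case: ifP.
have psi2_ge0 s v : 0 <= psi2 s v.
  by rewrite /psi2; case: ifP => // _; rewrite sqr_ge0.
pose G (f : {ffun step -> V} * {ffun 'I_q -> V}) :=
  (\prod_s psi1 s (f.1 s)) * (\prod_r psi2 r (f.2 r)).
have G0 f : 0 <= G f by apply: mulr_ge0; apply: prodr_ge0.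
set D := [set W | paired W && (pattern W == P)].
have injc : {in D &, injective code}.
  move=> W W' /[!inE] /andP[_ /eqP PW] /andP[_ /eqP PW'] [/ffunP e1 /ffunP e2].
  apply: (@pattern_code_inj P) => //.
    by move=> s fs; have := e1 s; rewrite !ffunE fs.
  by move=> r fr; have := e2 r; rewrite !ffunE fr.
apply: (@le_trans _ _ (\sum_(W in D) G (code W))).
  rewrite [leRHS](eq_bigl (fun W => paired W && (pattern W == P))); last first.
    by move=> W; rewrite inE.
  apply: ler_sum => W /andP[gW /eqP PW].
  apply: le_trans (paired_start_le x01 gW PW) _.
  rewrite /G [X in _ <= X * _]big1 ?mul1r; last first.
    by move=> s _; rewrite /psi1 /= ffunE; case: eqP => // _; rewrite eqxx.
  rewrite big_mkcond /=; apply: ler_prod => r _.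
  rewrite /psi2 /= ffunE; case: (free_start P r); first by rewrite sqr_ge0 lexx.
  by rewrite eqxx ler01 lexx.
have -> : \sum_(W in D) G (code W) = \sum_(f in code @: D) G f by rewrite big_imset.
apply: (@le_trans _ _ (\sum_f G f)).
  by rewrite [leRHS](bigID (mem (code @: D))) /= lerDl sumr_ge0.
rewrite /G -(pair_big xpredT xpredT (fun (f : {ffun step -> V}) (g : {ffun 'I_q -> V}) =>
  (\prod_s psi1 s (f s)) * (\prod_r psi2 r (g r)))) /=.
under eq_bigr do rewrite -mulr_sumr.
rewrite -mulr_suml -(bigA_distr_bigA psi1) -(bigA_distr_bigA psi2) /=.
have -> : \prod_i \sum_j psi1 i j = #|V|%:R ^+ #|[set s | P s == s]|.
  rewrite (bigID (fun s => P s == s)) /= [X in _ * X]big1 ?mulr1 => [|s /negbTE fs].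
    rewrite -prodr_const; apply: eq_big => [s|s fs]; rewrite ?inE //.
    by under eq_bigr do rewrite /psi1 fs; rewrite sumr_const.
  under eq_bigr do rewrite /psi1 fs.
  by rewrite (bigD1 v0) //= eqxx big1 ?addr0 // => v /negbTE ->.
rewrite ler_piMr ?exprn_ge0 ?ler0n //.
apply: prodr_ile1 => r _; rewrite sumr_ge0 //=.
have [fr|/negbTE fr] := boolP (free_start P r).
  by under eq_bigr do rewrite /psi2 fr.
under eq_bigr do rewrite /psi2 fr.
by rewrite (bigD1 v0) //= eqxx big1 ?addr0 // => v /negbTE ->.
Qed.

End WalkPatterns.

(** With [m = #|S|] and [e] fixed points, the hypotheses bound the weight by [rho^m / m^(m - e)]:
    each element that is not fixed pays [1 / m] for the choice of its image. Summed over all maps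
    this is a product of [m] factors [1 + (m - 1) / m <= 2]. *)
Lemma sum_pattern_weight (R : realType) (S : finType) (a sigma B rho : R) :
  0 <= a -> 0 <= sigma -> 0 <= B -> 0 <= rho ->
  sigma ^+ 2 * a * #|S|%:R <= rho ^+ 2 -> B * #|S|%:R <= rho ->
  \sum_(P : {ffun S -> S} | (2 * #|[set s | P s == s]| <= #|S|)%N)
     a ^+ #|[set s | P s == s]| * ((sigma ^+ 2) ^+ #|[set s | P s == s]| *
       B ^+ (#|S| - 2 * #|[set s | P s == s]|)) <= (2 * rho) ^+ #|S|.
Proof.
move=> a0 s0 B0 r0 h1 h2.
have [S0|Sgt0] := posnP #|S|.
  have e (P : {ffun S -> S}) : #|[set s | P s == s]| = 0%N.
    by apply/eqP; rewrite -leqn0 -S0 max_card.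
  under eq_bigr do rewrite !e S0 /= !expr0 !mulr1.
  rewrite S0 expr0 sumr_const (_ : #|_| = 1%N) //.
  rewrite -(@eq_card _ predT) ?card_ffun ?S0 // => P.
  by rewrite !inE unfold_in e.
set m := #|S| in Sgt0 h1 h2 *.
have m0 : 0 < (m%:R : R) by rewrite ltr0n.
pose psi (s t : S) : R := if t == s then 1 else m%:R^-1.
have psi0 s t : 0 <= psi s t.
  by rewrite /psi; case: ifP => // _; rewrite invr_ge0 ler0n.
apply: (@le_trans _ _ (\sum_(P : {ffun S -> S}) rho ^+ m * \prod_s psi s (P s))).
  rewrite [leRHS](bigID (fun P : {ffun S -> S} =>
     (2 * #|[set s | P s == s]| <= m)%N)) /= -[leLHS]addr0.
  apply: lerD; last first.
    by apply: sumr_ge0 => P _; rewrite mulr_ge0 ?exprn_ge0 ?prodr_ge0.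
  apply: ler_sum => P; set e := #|_| => em.
  have -> : \prod_s psi s (P s) = m%:R^-1 ^+ (m - e).
    rewrite (bigID (fun s => P s == s)) /= big1 ?mul1r => [|s fs]; last first.
      by rewrite /psi fs.
    under eq_bigr => s /negbTE fs do rewrite /psi fs.
    rewrite prodr_const; congr (_ ^+ _).
    have := cardC [set s | P s == s]; rewrite -/m -/e => <-.
    by rewrite addKn; apply: eq_card => s; rewrite !inE.
  have -> : m%:R^-1 ^+ (m - e) = m%:R^-1 ^+ e * m%:R^-1 ^+ (m - 2 * e) :> R.
    by rewrite -exprD; congr (_ ^+ _); lia.
  have -> : rho ^+ m = (rho ^+ 2) ^+ e * rho ^+ (m - 2 * e).
    by rewrite -exprM -exprD; congr (_ ^+ _); lia.
  rewrite mulrA -exprMn mulrACA -!exprMn.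
  apply: ler_pM; rewrite ?exprn_ge0 ?mulr_ge0 ?sqr_ge0 //.
    apply: lerXn2r; rewrite ?nnegrE ?mulr_ge0 ?invr_ge0 ?sqr_ge0 ?ler0n //.
    by rewrite ler_pdivlMr // [a * _]mulrC.
  apply: lerXn2r; rewrite ?nnegrE ?mulr_ge0 ?invr_ge0 ?ler0n //.
  by rewrite ler_pdivlMr.
rewrite -mulr_sumr -(bigA_distr_bigA psi) /= exprMn mulrC.
apply: ler_wpM2r; first exact: exprn_ge0.
rewrite -prodr_const; apply: ler_prod => s _; rewrite sumr_ge0 //=.
rewrite (bigD1 s) //= {1}/psi eqxx.
under eq_bigr => t /negbTE ts do rewrite /psi ts.
rewrite sumr_const -[leRHS]/(1 + 1) lerD2l -[_ *+ #|_|]mulr_natl ler_pdivrMr // mul1r.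
by rewrite ler_nat max_card.
Qed.

(** * Expectation of bounded measurable functions *)

Section BoundedMeasurable.
Local Open Scope classical_set_scope.
Local Open Scope ring_scope.
Context d (T : measurableType d) (R : realType).
Implicit Types f g : T -> R.

(** Boundedness gives a class closed under products and always integrable, so that expectations are
    manipulated without integrability conditions. *)
Definition bmeas f : Prop :=
  measurable_fun [set: T] f /\ exists M, forall w, `|f w| <= M.

Lemma bmeas_cst c : bmeas (fun=> c).
Proof. by split; [exact: measurable_cst|exists `|c|]. Qed.

Lemma bmeasD f g : bmeas f -> bmeas g -> bmeas (fun w => f w + g w).
Proof.
move=> [mf [M fM]] [mg [N gN]]; split; first exact: measurable_funD.
by exists (M + N) => w; rewrite (le_trans (ler_normD _ _))// lerD.
Qed.

Lemma bmeasM f g : bmeas f -> bmeas g -> bmeas (fun w => f w * g w).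
Proof.
move=> [mf [M fM]] [mg [N gN]]; split; first exact: measurable_funM.
by exists (M * N) => w; rewrite normrM ler_pM.
Qed.

Lemma bmeasZ c f : bmeas f -> bmeas (fun w => c * f w).
Proof. by apply: bmeasM; apply: bmeas_cst. Qed.

Lemma bmeasX f k : bmeas f -> bmeas (fun w => f w ^+ k).
Proof.
move=> bf; elim: k => [|k IH]; first exact: bmeas_cst.
by under eq_fun do rewrite exprS; exact: bmeasM.
Qed.

Lemma bmeas_sum I (s : seq I) (P : pred I) (F : I -> T -> R) :
  (forall i, bmeas (F i)) -> bmeas (fun w => \sum_(i <- s | P i) F i w).
Proof.
move=> bF; elim: s => [|i s IH].
  by under eq_fun do rewrite big_nil; exact: bmeas_cst.
under eq_fun do rewrite big_cons.
by case: (P i) => //; apply: bmeasD.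
Qed.

Lemma bmeas_prod I (s : seq I) (P : pred I) (F : I -> T -> R) :
  (forall i, bmeas (F i)) -> bmeas (fun w => \prod_(i <- s | P i) F i w).
Proof.
move=> bF; elim: s => [|i s IH].
  by under eq_fun do rewrite big_nil; exact: bmeas_cst.
under eq_fun do rewrite big_cons.
by case: (P i) => //; apply: bmeasM.
Qed.

Lemma bmeas_indic (A : set T) : measurable A -> bmeas (\1_A : T -> R).
Proof.
move=> mA; split; first exact: measurable_indic.
by exists 1 => w; rewrite indicE; case: (_ \in _); rewrite ?normr1 ?normr0.
Qed.

End BoundedMeasurable.

Lemma bmeas_comp d (T : measurableType d) (R : realType) (f : R -> R)
    (X : T -> R) :
  bmeas f -> measurable_fun [set: T]%classic X -> bmeas (fun w => f (X w)).
Proof.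
move=> [mf [M fM]] mX; split; last by exists M.
exact: (measurableT_comp mf mX).
Qed.

Section Expectation.
Local Open Scope classical_set_scope.
Local Open Scope ring_scope.
Context d (T : measurableType d) (R : realType) (P : probability T R).
Implicit Types f g : T -> R.

Lemma bmeas_integrable f : bmeas f -> P.-integrable [set: T] (EFin \o f).
Proof.
move=> [mf [M fM]]; apply: measurable_bounded_integrable => //.
  by apply: (@le_lt_trans _ _ 1%E); [exact: probability_le1|rewrite ltry].
exists M; split; first exact: num_real.
by move=> N MN w _ /=; rewrite (le_trans (fM w))// ltW.
Qed.

Definition Ex f : R := \int[P]_w f w.

Lemma Ex_cst c : Ex (fun=> c) = c.
Proof.
rewrite /Ex Rintegral_cst// -[RHS]mulr1; congr (_ * _).
exact: (congr1 fine (probability_setT P)).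
Qed.

Lemma ExD f g : bmeas f -> bmeas g -> Ex (fun w => f w + g w) = Ex f + Ex g.
Proof. by move=> bf bg; rewrite /Ex RintegralD//; exact: bmeas_integrable. Qed.

Lemma ExZ c f : bmeas f -> Ex (fun w => c * f w) = c * Ex f.
Proof. by move=> bf; rewrite /Ex RintegralZl//; exact: bmeas_integrable. Qed.

Lemma Ex_sum I (s : seq I) (Q : pred I) (F : I -> T -> R) :
  (forall i, bmeas (F i)) ->
  Ex (fun w => \sum_(i <- s | Q i) F i w) = \sum_(i <- s | Q i) Ex (F i).
Proof.
move=> bF; elim: s => [|i s IH].
  by rewrite big_nil; under [LHS]eq_Rintegral do rewrite big_nil; rewrite -/(Ex _) Ex_cst.
rewrite big_cons -IH; case Qi: (Q i).
  rewrite -ExD//; last exact: bmeas_sum.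
  by congr (Ex _); apply/funext => w; rewrite big_cons Qi.
by congr (Ex _); apply/funext => w; rewrite big_cons Qi.
Qed.

Lemma Ex_le f g : bmeas f -> bmeas g -> (forall w, f w <= g w) -> Ex f <= Ex g.
Proof. by move=> bf bg fg; apply: le_Rintegral => //; exact: bmeas_integrable. Qed.

Lemma Ex_normr_le f M : bmeas f -> (forall w, `|f w| <= M) -> `|Ex f| <= M.
Proof.
move=> bf fM; rewrite ler_norml -{1}(Ex_cst (- M)) -{2}(Ex_cst M).
by apply/andP; split; apply: Ex_le => //; try exact: bmeas_cst;
  move=> w; have := fM w; rewrite ler_norml => /andP[].
Qed.

Lemma Ex_indic A : measurable A -> Ex \1_A = fine (P A).
Proof. by move=> mA; rewrite /Ex /Rintegral integral_indic// setIT. Qed.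

(** In this range the sum is the integer part of [x]; rescaled, it approximates a bounded function
    by a step function. *)
Lemma layer_cake J (x : R) : 0 <= x <= J%:R ->
  0 <= x - \sum_(j < J) (j.+1%:R <= x)%R%:R <= 1.
Proof.
elim: J x => [|J IH] x /andP[x0 xJ].
  by rewrite big_ord0 subr0 x0 (le_trans xJ).
have [xJ1|xJ1] := leP x J%:R.
  have -> : \sum_(j < J.+1) (j.+1%:R <= x)%R%:R =
            \sum_(j < J) (j.+1%:R <= x)%R%:R :> R.
    rewrite big_ord_recr /= (_ : (_ <= x) = false) ?addr0// leNgt.
    by rewrite (le_lt_trans xJ1) ?ltr_nat.
  by rewrite IH ?x0.
have e : \sum_(j < J) (j.+1%:R <= x)%R%:R = J%:R :> R.
  transitivity (\sum_(j < J) (1 : R)); last by rewrite sumr_const card_ord.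
  apply: eq_bigr => j _; have jx : (j.+1%:R : R) <= x.
    by rewrite (le_trans _ (ltW xJ1))// ler_nat.
  by rewrite jx.
rewrite big_ord_recr /= e.
have xJ' : x <= J%:R + 1 by rewrite natr1.
by case: (leP J.+1%:R x) => /= h; apply/andP; split; move: h; rewrite -natr1; lra.
Qed.

(* Both sides are continuous in [f] for the uniform norm, and bounded
   measurable functions are uniform limits of simple ones. *)
Lemma Ex_indic_ext (f : R -> R) (X1 X2 Y1 Y2 : T -> R) (c : R) :
  measurable_fun [set: T] X1 -> measurable_fun [set: T] X2 ->
  bmeas Y1 -> bmeas Y2 -> bmeas f ->
  (forall A : set R, measurable A ->
    Ex (fun w => \1_A (X1 w) * Y1 w) = c * Ex (fun w => \1_A (X2 w) * Y2 w)) ->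
  Ex (fun w => f (X1 w) * Y1 w) = c * Ex (fun w => f (X2 w) * Y2 w).
Proof.
move=> mX1 mX2 bY1 bY2 bf H.
have [mf [M0 fM0]] := bf.
have [K1 Y1K] := bY1.2; have [K2 Y2K] := bY2.2.
pose M := `|M0| + 1.
have M1 : 0 < M by rewrite /M ltr_wpDl.
have fM x : `|f x| <= M.
  by rewrite (le_trans (fM0 x))// (le_trans (ler_norm _))// lerDl.
(* Superlevel sets of [f] at [J] equally spaced heights in [[-M, M]]; the combination [g J] of their
   indicators stays within [2 * M / J] of [f]. *)
pose A J (j : nat) : set R := [set x | (j.+1%:R : R) <= (f x + M) * J%:R / (2 * M)].
have mA J j : measurable (A J j).
  have -> : A J j = (fun x => (f x + M) * J%:R / (2 * M)) @^-1` `[j.+1%:R, +oo[.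
    by apply/seteqP; split => x /=; rewrite in_itv /= andbT.
  rewrite -[X in measurable X]setTI; have : measurable_fun [set: R]
      (fun x => (f x + M) * J%:R / (2 * M)); last by apply; [|exact: measurable_itv].
  apply: measurable_funM; last exact: measurable_cst.
  apply: measurable_funM; last exact: measurable_cst.
  by apply: measurable_funD => //; exact: measurable_cst.
pose g J x : R := 2 * M / J%:R * (\sum_(j < J) \1_(A J j) x) - M.
have gf J x : (0 < J)%N -> `|f x - g J x| <= 2 * M / J%:R.
  move=> J0; have J0' : 0 < (J%:R : R) by rewrite ltr0n.
  have := fM x; rewrite ler_norml => /andP[h1 h2].
  have /layer_cake : 0 <= (f x + M) * J%:R / (2 * M) <= J%:R.
    apply/andP; split.
      by rewrite divr_ge0 ?mulr_ge0 ?ler0n ?(ltW M1)//; lra.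
    by rewrite ler_pdivrMr ?mulr_gt0// mulrC ler_wpM2l ?ler0n//; lra.
  rewrite /g; set s := \sum_(j < J) _; set t := \sum_(j < J) _.
  have -> : t = s.
    by apply: eq_bigr => j _; rewrite indicE /A mem_setE.
  have e : f x - (2 * M / J%:R * s - M) =
      2 * M / J%:R * ((f x + M) * J%:R / (2 * M) - s).
    by field; rewrite !gt_eqF.
  case/andP => a b; rewrite e normrM [X in X * _]ger0_norm; last first.
    by rewrite divr_ge0 ?mulr_ge0 ?(ltW M1)// ?(ltW J0').
  by rewrite ler_piMr ?divr_ge0 ?mulr_ge0 ?(ltW M1) ?(ltW J0')// ger0_norm.
have bg J : bmeas (g J).
  apply: bmeasD; last exact: bmeas_cst.
  by apply: bmeasZ; apply: bmeas_sum => j; apply: bmeas_indic.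
have expand J X Y : measurable_fun [set: T] X -> bmeas Y ->
    Ex (fun w => g J (X w) * Y w) =
    2 * M / J%:R * (\sum_(j < J) Ex (fun w => \1_(A J j) (X w) * Y w)) - M * Ex Y.
  move=> mX bY.
  have bj (j : 'I_J) : bmeas (fun w => \1_(A J j) (X w) * Y w).
    apply: bmeasM => //.
    exact: (bmeas_comp (f := \1_(A J j)) (bmeas_indic _ (mA J j)) mX).
  rewrite -Ex_sum// -mulNr -!ExZ//; last exact: bmeas_sum.
  rewrite -ExD; last exact: bmeasZ.
    by congr (Ex _); apply/funext => w; rewrite /g -mulr_suml; ring.
  by apply: bmeasZ; exact: bmeas_sum.
have gE J : Ex (fun w => g J (X1 w) * Y1 w) = c * Ex (fun w => g J (X2 w) * Y2 w).
  rewrite !expand//.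
  have -> : Ex Y1 = c * Ex Y2.
    have := H setT measurableT.
    by under eq_fun do rewrite indicT mul1r; under [X in _ = _ * Ex X]eq_fun do rewrite indicT mul1r.
  under eq_bigr do rewrite H//.
  by rewrite -mulr_sumr; ring.
have close J X Y K : (0 < J)%N -> measurable_fun [set: T] X -> bmeas Y ->
    (forall w, `|Y w| <= K) ->
    `|Ex (fun w => f (X w) * Y w) - Ex (fun w => g J (X w) * Y w)|
      <= 2 * M / J%:R * K.
  move=> J0 mX bY YK.
  have bfX := bmeasM (bmeas_comp bf mX) bY.
  have bgX := bmeasM (bmeas_comp (bg J) mX) bY.
  rewrite -mulN1r -ExZ// -ExD//; last exact: bmeasZ.
  apply: Ex_normr_le; first by apply: bmeasD => //; exact: bmeasZ.
  by move=> w; rewrite mulN1r -mulrBl normrM ler_pM// gf.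
apply/eqP; rewrite -subr_eq0 -normr_eq0 eq_le normr_ge0 andbT.
set D := `|_|.
have DJ J : (0 < J)%N -> D <= (2 * M * (`|K1| + `|c| * `|K2|)) / J%:R.
  move=> J0.
  have h1 := close J X1 Y1 _ J0 mX1 bY1 (fun w => le_trans (Y1K w) (ler_norm _)).
  have h2 := close J X2 Y2 _ J0 mX2 bY2 (fun w => le_trans (Y2K w) (ler_norm _)).
  rewrite /D; set a := Ex _ in h1 *; set b := Ex _ in h2 *.
  have -> : a - c * b = (a - Ex (fun w => g J (X1 w) * Y1 w)) -
     c * (b - Ex (fun w => g J (X2 w) * Y2 w)).
    by rewrite mulrBr -gE; ring.
  rewrite (le_trans (ler_normB _ _))// normrM.
  rewrite (_ : 2 * M * _ / _ = 2 * M / J%:R * `|K1| + `|c| * (2 * M / J%:R * `|K2|)); last by ring.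
  by rewrite lerD// ler_wpM2l.
rewrite leNgt; apply/negP => D0.
set C := 2 * M * _ in DJ.
have := DJ (Num.truncn (C / D)).+1 isT.
rewrite ler_pdivlMr// => h.
have : C / D < (Num.truncn (C / D)).+1%:R by exact: truncnS_gt.
by rewrite ltr_pdivrMr// mulrC ltNge h.
Qed.

(** Indicators are replaced by the [g i] one coordinate at a time: the induction runs over a list of
    coordinates outside which [g] is still an indicator, and the other factors form the weight [Y]
    in [Ex_indic_ext]. *)
Lemma independent_Ex (I : finType) (X : I -> T -> R) :
  (forall i, measurable_fun [set: T] (X i)) ->
  (forall A : I -> set R, (forall i, measurable (A i)) ->
     Ex (fun w => \prod_i \1_(A i) (X i w)) =
     \prod_i Ex (fun w => \1_(A i) (X i w))) ->
  forall g : I -> R -> R, (forall i, bmeas (g i)) ->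
    Ex (fun w => \prod_i g i (X i w)) = \prod_i Ex (fun w => g i (X i w)).
Proof.
move=> mX H.
suff aux (s : seq I) (g : I -> R -> R) : (forall i, bmeas (g i)) ->
    (forall i, i \notin s -> exists2 A : set R, measurable A & g i = \1_A) ->
    Ex (fun w => \prod_i g i (X i w)) = \prod_i Ex (fun w => g i (X i w)).
  move=> g bg; apply: (aux (enum I)) => // i.
  by rewrite mem_enum.
elim: s g => [|i0 s IH] g bg Hg.
  have [A HA] : {A : I -> set R & forall i, measurable (A i) /\ g i = \1_(A i)}.
    by apply: (@choice I (set R) (fun i A => measurable A /\ g i = \1_A)) => i; have [A mA ->] := Hg i isT; exists A.
  under eq_fun do under eq_bigr => i _ do rewrite (HA i).2.
  rewrite H; last by move=> i; case: (HA i).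
  by apply: eq_bigr => i _; rewrite (HA i).2.
have bgX i : bmeas (fun w => g i (X i w)) by exact: bmeas_comp.
pose Y w := \prod_(i | i != i0) g i (X i w).
have bY : bmeas Y by exact: bmeas_prod.
have := @Ex_indic_ext (g i0) (X i0) (X i0) Y (fun=> 1)
  (\prod_(i | i != i0) Ex (fun w => g i (X i w))) (mX i0) (mX i0) bY
  (bmeas_cst _ 1) (bg i0).
have -> : (fun w => \prod_i g i (X i w)) = (fun w => g i0 (X i0 w) * Y w).
  by apply/funext => w; rewrite (bigD1 i0).
move=> ->.
  rewrite [RHS](bigD1 i0)//= mulrC; congr (_ * _).
  by congr (Ex _); apply/funext => w; rewrite mulr1.
move=> A mA.
pose g' i := if i == i0 then \1_A : R -> R else g i.
have -> : (fun w => \1_A (X i0 w) * Y w) = (fun w => \prod_i g' i (X i w)).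
  apply/funext => w; rewrite (bigD1 i0)//= /g' eqxx; congr (_ * _).
  by apply: eq_bigr => i /negbTE ->.
rewrite IH.
- rewrite (bigD1 i0)//= mulrC /g' eqxx; congr (_ * _).
    by apply: eq_bigr => i /negbTE ->.
  by congr (Ex _); apply/funext => w; rewrite mulr1.
- by move=> i; rewrite /g'; case: eqP => // _; exact: bmeas_indic.
- move=> i si; rewrite /g'; case: eqP => [_|/eqP ii0]; first by exists A.
  by apply: Hg; rewrite inE negb_or ii0.
Qed.

End Expectation.

Lemma prod_fiber (R : comPzRingType) (S E : finType) (f : S -> E) (h : E -> R) :
  \prod_s h (f s) = \prod_e h e ^+ #|[set s | f s == e]|.
Proof.
rewrite (partition_big f xpredT) //=; apply: eq_bigr => e _.
by rewrite -prodr_const; apply: eq_big => [s|s /eqP -> //]; rewrite inE.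
Qed.

Lemma sum_fiber (S E : finType) (f : S -> E) :
  (\sum_(e in f @: setT) #|[set s | f s == e]| = #|S|)%N.
Proof.
rewrite -sum1_card (partition_big f (mem (f @: setT))) //= => [|s _]; last first.
  by apply: imset_f; rewrite inE.
by apply: eq_bigr => e _; rewrite -sum1_card; apply: eq_bigl => s; rewrite inE.
Qed.

(** * Moments of bilinear forms in a random matrix *)

Section Moments.
Context d (T : measurableType d) (R : realType) (P : probability T R).
Variables (n : nat) (h : 'I_n -> 'I_n -> T -> R) (sigma B : R).
Hypotheses (hmeas : forall i j, measurable_fun [set: T]%classic (h i j))
  (hB : forall i j w, `|h i j w| <= B)
  (hprod : forall m : 'I_n * 'I_n -> nat,
     Ex P (fun w => \prod_e h e.1 e.2 w ^+ m e) =
     \prod_e Ex P (fun w => h e.1 e.2 w ^+ m e))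
  (h0 : forall i j, Ex P (h i j) = 0)
  (hvar : forall i j, Ex P (fun w => h i j w ^+ 2) <= sigma ^+ 2).

Lemma bmeas_entry i j : bmeas (h i j).
Proof. by split; last by exists B. Qed.

Lemma Ex_entry_le i j m : (1 < m)%N ->
  `|Ex P (fun w => h i j w ^+ m)| <= sigma ^+ 2 * B ^+ (m - 2).
Proof.
move=> m1; have bh := bmeas_entry i j.
have B0 : 0 <= B by rewrite (le_trans _ (hB i j point)).
have Bk : 0 <= B ^+ (m - 2) by rewrite exprn_ge0.
have b2 := bmeasX 2 bh; have bm := bmeasX m bh.
have lem w : `|h i j w ^+ m| <= h i j w ^+ 2 * B ^+ (m - 2).
  rewrite -{1}(subnKC m1) exprD normrM normrX real_normK ?num_real//.
  by rewrite ler_wpM2l ?sqr_ge0// normrX lerXn2r ?nnegrE ?hB.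
have bmB : bmeas (fun w => h i j w ^+ 2 * B ^+ (m - 2)).
  by apply: bmeasM => //; exact: bmeas_cst.
apply: (@le_trans _ _ (Ex P (fun w => h i j w ^+ 2 * B ^+ (m - 2)))).
  rewrite ler_norml; apply/andP; split.
    rewrite -[X in - X]mul1r -mulNr -ExZ//; apply: Ex_le => //; first exact: bmeasZ.
    by move=> w; have := lem w; rewrite ler_norml mulN1r => /andP[].
  by apply: Ex_le => // w; have := lem w; rewrite ler_norml => /andP[].
under eq_fun do rewrite mulrC.
by rewrite ExZ// mulrC ler_wpM2r.
Qed.

(** Grouped by edges, the expectation is a product. An edge used once contributes a zero mean; an
    edge used [m >= 2] times contributes at most [sigma^2 B^(m - 2)], and the exponents of [B] add
    up to the number of steps minus twice the number of edges. *)
Lemma Ex_monomial_le (S : finType) (f : S -> 'I_n * 'I_n) :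
  `|Ex P (fun w => \prod_s h (f s).1 (f s).2 w)| <=
  if [forall s, exists s', (s' != s) && (f s' == f s)] then
    (sigma ^+ 2) ^+ #|f @: setT| * B ^+ (#|S| - 2 * #|f @: setT|) else 0.
Proof.
have -> : (fun w => \prod_s h (f s).1 (f s).2 w) =
    (fun w => \prod_e h e.1 e.2 w ^+ #|[set s | f s == e]|).
  by apply/funext => w; rewrite (prod_fiber f (fun e => h e.1 e.2 w)).
rewrite hprod; case: ifPn => [/forallP pf|]; last first.
  rewrite negb_forall => /existsP[s]; rewrite negb_exists => /forallP ns.
  have c1 : #|[set s' | f s' == f s]| = 1%N.
    rewrite -(cards1 s); apply: eq_card => s'; rewrite !inE.
    by have := ns s'; case: eqVneq => [->|_ /=]; rewrite ?eqxx//; case: eqP.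
  have e0 : Ex P (fun w => h (f s).1 (f s).2 w ^+ 1) = 0 by exact: h0.
  by rewrite (bigD1 (f s)) //= c1 e0 mul0r normr0.
have c2 e : e \in f @: setT -> (1 < #|[set s | f s == e]|)%N.
  case/imsetP => s _ ->; have /existsP[s' /andP[ss' fs']] := pf s.
  rewrite (cardsD1 s) (cardsD1 s') !inE eqxx ss' fs'; lia.
rewrite normr_prod (bigID (mem (f @: setT))) /= [X in _ * X]big1 ?mulr1.
  have -> : (#|S| - 2 * #|f @: setT| =
      \sum_(e in f @: setT) (#|[set s | f s == e]| - 2))%N.
    rewrite -(sum_fiber f) (eq_bigr (fun e => (#|[set s | f s == e]| - 2) + 2)%N).
      by rewrite big_split /= sum_nat_const mulnC addnK.
    by move=> e /c2 e2; rewrite subnK.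
  rewrite -prodr_const -prodrXr -big_split /=; apply: ler_prod => e fe.
  by rewrite normr_ge0 Ex_entry_le// c2.
move=> e fe; rewrite (_ : #|_| = 0%N).
  by under eq_fun do rewrite expr0; rewrite Ex_cst normr1.
apply/eqP; rewrite cards_eq0; apply/eqP/setP => s; rewrite !inE.
by apply: contraNF fe => /eqP <-; apply: imset_f; rewrite inE.
Qed.

Definition rmat (w : T) : 'M[R]_n := \matrix_(i, j) h i j w.

Lemma bmeas_bilinear (x y : 'cV[R]_n) k :
  bmeas (fun w => (x^T *m rmat w ^+ k *m y) 0 0).
Proof.
under eq_fun do rewrite bilinear_walk_sum.
apply: bmeas_sum => W; apply: bmeasM; last exact: bmeas_cst.
apply: bmeasZ; apply: bmeas_prod => t.
by under eq_fun do rewrite mxE; exact: bmeas_entry.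
Qed.

(** The ends of the [q] walks cost [eta] each, while the starts keep their weights [x], which are
    summed in the l2 norm. The conditions on [rho] involve the total number [q * k.+1] of steps, as
    in [sum_pattern_weight]. *)
Lemma moment_bound (x y : 'cV[R]_n) (eta rho : R) q k :
  (0 < n)%N -> 0 <= sigma -> 0 <= B -> 0 <= rho ->
  \sum_i x i 0 ^+ 2 <= 1 -> (forall i, `|y i 0| <= eta) ->
  sigma ^+ 2 * n%:R * (q * k.+1)%:R <= rho ^+ 2 -> B * (q * k.+1)%:R <= rho ->
  Ex P (fun w => (x^T *m rmat w ^+ k.+1 *m y) 0 0 ^+ q)
    <= eta ^+ q * (2 * rho) ^+ (q * k.+1).
Proof.
move=> n_gt0 s0 B0 r0 x2 yeta Hs HB.
have x1 i : `|x i 0| <= 1.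
  rewrite -(@expr_le1 _ 2)// real_normK ?num_real// (le_trans _ x2)//.
  by rewrite (bigD1 i)//= lerDl sumr_ge0// => j _; rewrite sqr_ge0.
pose step := ('I_q * 'I_k.+1)%type.
pose walks := {ffun 'I_q -> {ffun 'I_k.+2 -> 'I_n}}.
have eta0 : 0 <= eta by rewrite (le_trans _ (yeta (Ordinal n_gt0))).
pose c (W : walks) := \prod_r (x (W r ord0) 0 * y (W r ord_max) 0).
pose mono (W : walks) w := \prod_(s : step) h (step_edge W s).1 (step_edge W s).2 w.
have bmono W : bmeas (mono W) by apply: bmeas_prod => s; exact: bmeas_entry.
have constX (a : R) : a ^+ q = \prod_(r < q) a.
  by rewrite prodr_const card_ord.
have -> : (fun w => (x^T *m rmat w ^+ k.+1 *m y) 0 0 ^+ q) =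
    (fun w => \sum_(W : walks) c W * mono W w).
  apply/funext => w; rewrite constX.
  under eq_bigr do rewrite bilinear_walk_sum.
  rewrite (bigA_distr_bigA (fun (_ : 'I_q) (w' : {ffun 'I_k.+2 -> 'I_n}) => x (w' ord0) 0 *
     walk_prod (rmat w) w' * y (w' ord_max) 0)) /=.
  apply: eq_bigr => W _; rewrite /c /mono.
  under eq_bigr do rewrite mulrAC.
  rewrite big_split /=; congr (_ * _).
  rewrite pair_big /=; apply: eq_bigr => -[r t] _ /=.
  by rewrite mxE.
rewrite Ex_sum; last by move=> W; exact: bmeasZ.
under eq_bigr do rewrite ExZ//.
pose e (Q : {ffun step -> step}) := #|[set s | Q s == s]|.
pose wt Q := (sigma ^+ 2) ^+ e Q * B ^+ (#|{: step}| - 2 * e Q).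
have wt0 Q : 0 <= wt Q by rewrite /wt mulr_ge0 ?exprn_ge0 ?sqr_ge0.
apply: (@le_trans _ _ (\sum_(W | paired W)
   eta ^+ q * ((\prod_r `|x (W r ord0) 0|) * wt (pattern W)))).
  rewrite [leRHS]big_mkcond /=; apply: ler_sum => W _.
  rewrite (le_trans (ler_norm _))// normrM.
  have := Ex_monomial_le (step_edge W).
  rewrite -/(mono W) -card_pattern -/(paired W) -/(wt (pattern W)).
  case: ifP => _ mb; last first.
    have -> : `|Ex P (mono W)| = 0 by apply/eqP; rewrite eq_le mb normr_ge0.
    by rewrite mulr0.
  rewrite mulrA ler_pM// /c normr_prod.
  under eq_bigr do rewrite normrM.
  rewrite big_split /= mulrC ler_wpM2r ?prodr_ge0//.
  rewrite constX; apply: ler_prod => r _.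
  by rewrite normr_ge0 yeta.
rewrite -mulr_sumr ler_wpM2l ?exprn_ge0//.
rewrite (partition_big (@pattern _ _ _) xpredT) //=.
have cS : #|{: step}| = (q * k.+1)%N by rewrite card_prod !card_ord.
rewrite -cS; apply: le_trans (@sum_pattern_weight _ {: step} n%:R sigma B rho _ _ _ _ _ _) => //; rewrite ?cS//.
rewrite [leRHS]big_mkcond /=; apply: ler_sum => Q _.
rewrite (eq_bigr (fun W : walks => (\prod_r `|x (W r ord0) 0|) * wt Q)); last first.
  by move=> W /andP[_ /eqP ->].
rewrite -mulr_suml.
case: ifP => eQ.
  rewrite -/(e Q) -cS -/(wt Q) ler_wpM2r//.
  rewrite -[X in X%:R]card_ord; 
  apply: (pattern_weight_sum (x := fun v => `|x v 0|) Q (Ordinal n_gt0)).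
  - by move=> v; rewrite normr_ge0 x1.
  - by under eq_bigr do rewrite real_normK ?num_real//.
(* No paired family has such a pattern: every edge is used at least twice, so there are at most half
   as many edges as steps. *)
rewrite big1 ?mul0r// => W /andP[pW /eqP WQ]; exfalso; move/negbT: eQ.
rewrite -cS -WQ card_pattern -ltnNge ltnNge => /negP; apply.
rewrite -(sum_fiber (step_edge W)) mulnC -sum_nat_const; apply: leq_sum => f /imsetP[s _ ->].
have /forallP/(_ s)/existsP[s' /andP[ss' fs']] := pW.
by rewrite (cardsD1 s) (cardsD1 s') !inE eqxx ss' fs'; lia.
Qed.

End Moments.

(** * Tail bounds *)

Section Tail.
Local Open Scope classical_set_scope.
Context d (T : measurableType d) (R : realType) (P : probability T R).

Lemma measurable_normr_gt (f : T -> R) t :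
  measurable_fun [set: T] f -> measurable [set w | t < `|f w|].
Proof.
move=> mf.
have -> : [set w | t < `|f w|] = (fun w => `|f w|) @^-1` `]t, +oo[.
  by apply/seteqP; split => w /=; rewrite in_itv /= andbT.
rewrite -[X in measurable X]setTI.
by apply: (measurableT_comp (@normr_measurable R setT) mf) => //; exact: measurable_itv.
Qed.

Lemma markov_power (f : T -> R) (t : R) q :
  bmeas f -> 0 < t -> ~~ odd q ->
  (P [set w | (t < `|f w|)%R] <= (Ex P (fun w => f w ^+ q) / t ^+ q)%:E)%E.
Proof.
move=> bf t0 qe; have mA := measurable_normr_gt t bf.1.
have fq w : f w ^+ q = `|f w| ^+ q.
  by rewrite -normrX ger0_norm// exprn_even_ge0.
rewrite -(@fineK _ (P _)) ?fin_num_measure// lee_fin.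
have bq := bmeasX q bf; have bA := bmeas_indic R mA.
rewrite ler_pdivlMr ?exprn_gt0// -Ex_indic// mulrC -ExZ//.
apply: Ex_le => //; first exact: bmeasZ.
move=> w; rewrite indicE fq; have [tf|tf] := ltP t `|f w|.
  by rewrite mem_set// mulr1 lerXn2r ?nnegrE// ltW.
by rewrite memNset ?mulr0 ?exprn_ge0//=; apply/negP; rewrite -leNgt.
Qed.

Lemma union_bound (I : finType) (A : I -> set T) (c : I -> R) :
  (forall i, measurable (A i)) -> (forall i, (P (A i) <= (c i)%:E)%E) ->
  with_probability_at_least P (1 - \sum_i c i) (fun w => forall i, ~ A i w).
Proof.
move=> mA Ac; pose E := \bigcap_(i in [set: I]) ~` A i.
have mE : measurable E.
  by apply: fin_bigcap_measurable => [|i _]; [exact: finite_finset|exact: measurableC].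
exists E; split => //; last by move=> w Ew i; exact: Ew.
rewrite -(@fineK _ (P E)) ?fin_num_measure// lee_fin lerBlDr.
have bE := bmeas_indic R mE; have bA i := bmeas_indic R (mA i).
apply: (@le_trans _ _ (Ex P (fun w => \1_E w + \sum_i \1_(A i) w))).
  rewrite -[leLHS](Ex_cst P 1); apply: Ex_le.
  - exact: bmeas_cst.
  - by apply: bmeasD => //; exact: bmeas_sum.
  move=> w; have [Ew|nEw] := pselect (E w).
    by rewrite [in leRHS]indicE mem_set// lerDl sumr_ge0.
  have [i Aiw] : exists i, A i w.
    by apply: contrapT => nA; apply: nEw => i _ Ai; apply: nA; exists i.
  rewrite (bigD1 i)//= [in X in _ <= _ + (X + _)]indicE mem_set//.
  by rewrite addrCA lerDl addr_ge0// sumr_ge0.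
rewrite ExD//; last exact: bmeas_sum.
rewrite Ex_sum// Ex_indic// lerD2l; apply: ler_sum => i _.
by rewrite Ex_indic// -lee_fin fineK ?fin_num_measure.
Qed.

End Tail.

(** * Tail bounds for powers of logarithmic order *)

Section LogTail.
Local Open Scope classical_set_scope.
Context d (T : measurableType d) (R : realType) (P : probability T R).

(** From [exp (-1/2) >= 1 - 1/2]. It makes [1 <= 2 * ln n] for [n >= 2], whence the [3] in
    [log_steps_ub]. *)
Lemma ln2_ge_half : 2^-1 <= ln 2 :> R.
Proof.
rewrite -ler_expR lnK ?posrE//.
have := expR_ge1Dx (- 2^-1 : R); rewrite expRN => h.
rewrite -[leLHS]invrK -[leRHS]invrK lef_pV2 ?posrE ?invr_gt0 ?expR_gt0//.
by apply: le_trans h; lra.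
Qed.

(** The number of exponents submitted to the union bound; the successor ensures [n <= e ^ N]. *)
Definition log_steps n : nat := (Num.truncn (ln (n%:R : R))).+1.

Lemma log_steps_ub n : (1 < n)%N -> (log_steps n)%:R <= 3 * ln (n%:R : R).
Proof.
move=> n1; have h2 := ln2_ge_half.
have h : ln (2 : R) <= ln n%:R by rewrite ler_ln ?posrE ?ltr0n ?ler_nat//; lia.
have /andP[+ _] := @truncn_itv _ (ln (n%:R : R)) (ltac:(lra)).
rewrite /log_steps -natr1; lra.
Qed.

Lemma nat_le_expR_log_steps n : (0 < n)%N -> n%:R <= expR 1 ^+ log_steps n :> R.
Proof.
move=> n0; rewrite -expRM_natl mulr1 -[leLHS]lnK ?posrE ?ltr0n// ler_expR.
exact/ltW/truncnS_gt.
Qed.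

(** Markov's inequality for a moment with [m] steps in all, where [m <= 12 ln n] allows
    [rho = 12 * L] in [moment_bound]. The threshold exceeds the resulting [24 * L] by [e^8] per
    step, which leaves [e^(-8 m) <= e^(-16 N) <= n^-16]. *)
Lemma bilinear_tail n (h : 'I_n -> 'I_n -> T -> R) (sigma B L eta : R)
    (x y : 'cV[R]_n) k :
  (forall i j, measurable_fun [set: T] (h i j)) ->
  (forall i j w, `|h i j w| <= B) ->
  (forall m : 'I_n * 'I_n -> nat,
     Ex P (fun w => \prod_e h e.1 e.2 w ^+ m e) =
     \prod_e Ex P (fun w => h e.1 e.2 w ^+ m e)) ->
  (forall i j, Ex P (h i j) = 0) ->
  (forall i j, Ex P (fun w => h i j w ^+ 2) <= sigma ^+ 2) ->
  (1 < n)%N -> 0 <= sigma -> 0 <= B -> 0 < L ->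
  sigma ^+ 2 * (n%:R * ln n%:R) <= L ^+ 2 -> B * ln n%:R <= L ->
  \sum_i x i 0 ^+ 2 <= 1 -> 0 < eta -> (forall i, `|y i 0| <= eta) ->
  (k < log_steps n)%N ->
  (P [set w | (eta * (24 * expR 1 ^+ 8 * L) ^+ k.+1 <
     `|(x^T *m rmat h w ^+ k.+1 *m y) 0 0|)%R] <= (n%:R ^- 16)%:E)%E.
Proof.
move=> hm hB hprod h0 hv n1 s0 B0 L0 Ls LB x2 eta0 yeta kN.
have n0 : (0 < n)%N by lia.
set N := log_steps n in kN *; set t := 24 * _ * L.
have e0 : 0 < expR 1 :> R by exact: expR_gt0.
have t0 : 0 < t by rewrite /t !mulr_gt0// exprn_gt0.
(* An even order, as Markov's inequality is used with an even power, adapted to [k] so that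
   [2 N <= m <= 4 N] for every [k < N]. *)
pose q := (2 * (N %/ k.+1).+1)%N.
pose m := (q * k.+1)%N.
have mlb : (2 * N <= m)%N.
  by rewrite /m /q -mulnA leq_mul2l /=; have := ltn_ceil N (ltn0Sn k); lia.
have mub : (m <= 4 * N)%N.
  rewrite /m /q -mulnA mulSn; have := leq_trunc_div N k.+1; lia.
have mln : m%:R <= 12 * ln (n%:R : R).
  have := log_steps_ub n1; rewrite -/N.
  have : m%:R <= (4 * N)%:R :> R by rewrite ler_nat.
  rewrite natrM; lra.
have bf := bmeas_bilinear hm hB x y k.+1.
have et0 : 0 < eta * t ^+ k.+1 by rewrite mulr_gt0// exprn_gt0.
have := @markov_power _ _ _ P _ (eta * t ^+ k.+1) q bf et0; rewrite /q oddM.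
move=> /(_ isT); rewrite -/q => hP; apply: (le_trans hP).
rewrite lee_fin.
have r0 : 0 <= 12 * L by rewrite mulr_ge0// ltW.
have := @moment_bound _ _ _ P _ h sigma B hm hB hprod h0 hv x y eta (12 * L) q k
  n0 s0 B0 r0 x2 yeta.
rewrite -/m => mom.
have t0m : 0 < (eta * t ^+ k.+1) ^+ q by rewrite exprn_gt0// mulr_gt0// exprn_gt0.
rewrite ler_pdivrMr//; apply: le_trans (mom _ _) _.
- apply: (@le_trans _ _ (sigma ^+ 2 * n%:R * (12 * ln n%:R))).
    by rewrite ler_wpM2l// mulr_ge0 ?sqr_ge0// ler0n.
  have -> : sigma ^+ 2 * n%:R * (12 * ln n%:R) = 12 * (sigma ^+ 2 * (n%:R * ln n%:R)) by ring.
  have l2 : 12 * (sigma ^+ 2 * (n%:R * ln n%:R)) <= 12 * L ^+ 2 by rewrite ler_wpM2l.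
  apply: (le_trans l2); rewrite exprMn ler_wpM2r ?sqr_ge0//.
  by rewrite -natrX ler_nat.
- apply: (@le_trans _ _ (B * (12 * ln n%:R))); first by rewrite ler_wpM2l.
  by rewrite mulrCA ler_wpM2l.
rewrite [(eta * _) ^+ q]exprMn [leRHS]mulrCA ler_wpM2l ?exprn_ge0 ?(ltW eta0)//.
have -> : 2 * (12 * L) = (expR 1 ^+ 8)^-1 * t by rewrite /t; field; rewrite gt_eqF// exprn_gt0.
rewrite -exprM (_ : (k.+1 * q)%N = m); last by rewrite mulnC.
rewrite exprMn ler_wpM2r ?exprn_ge0 ?(ltW t0)//.
rewrite exprVn lef_pV2 ?posrE ?exprn_gt0 ?ltr0n//.
apply: (@le_trans _ _ ((expR 1 ^+ N) ^+ 16)).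
  by rewrite lerXn2r ?nnegrE ?exprn_ge0 ?ler0n ?(ltW e0)// nat_le_expR_log_steps.
have N8 : (N * 16 <= 8 * m)%N by rewrite (_ : 16 = 8 * 2)%N // mulnCA leq_mul2l mulnC mlb.
rewrite -!exprM; apply: ler_weXn2l; last exact: N8.
by rewrite -[leLHS]expR0 ler_expR.
Qed.

End LogTail.

(** * From short powers to all powers *)

Section Powers.
Variables (R : realType) (n N : nat) (A : 'M[R]_n) (t b : R).
Hypotheses (n0 : (0 < n)%N) (N0 : (0 < N)%N) (t0 : 0 <= t) (b1 : 1 <= b)
  (nb : n%:R <= b ^+ N)
  (At : forall k i j, (0 < k <= N)%N -> `|(A ^+ k) i j| <= t ^+ k).

(** The power is cut into blocks of length [N]. Each block brings a sum over one intermediate index,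
    hence a factor [n <= b ^+ N], which is spread as [b] per step. *)
Lemma entry_power_le k i j : `|(A ^+ k) i j| <= (b * t) ^+ k.
Proof.
have At' r i' j' : (r <= N)%N -> `|(A ^+ r) i' j'| <= t ^+ r.
  case: r => [|r] rN; last by apply: At.
  by rewrite expr0 mxE; case: eqP => _; rewrite ?normr1 ?normr0.
have aux q r i' j' : (r <= N)%N ->
    `|(A ^+ (N * q + r)) i' j'| <= n%:R ^+ q * t ^+ (N * q + r).
  move=> rN; elim: q i' j' => [|q IH] i' j'.
    by rewrite muln0 add0n expr0 mul1r At'.
  rewrite mulnS -addnA exprD mxE (le_trans (ler_norm_sum _ _ _))//.
  apply: (@le_trans _ _ (\sum_(l < n) t ^+ N * (n%:R ^+ q * t ^+ (N * q + r)))).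
    apply: ler_sum => l _; rewrite normrM ler_pM//.
    by rewrite At' .
  rewrite sumr_const card_ord -mulr_natl exprS [t ^+ (N + _)]exprD.
  by rewrite le_eqVlt; apply/orP; left; apply/eqP; ring.
rewrite (divn_eq k N) mulnC exprMn.
apply: le_trans (aux _ _ _ _ _) _; first by rewrite ltnW// ltn_pmod.
rewrite ler_wpM2r ?exprn_ge0//.
apply: (@le_trans _ _ ((b ^+ N) ^+ (k %/ N))).
  by rewrite lerXn2r ?nnegrE ?ler0n ?exprn_ge0 ?(le_trans ler01).
by rewrite -exprM ler_weXn2l// leq_addr.
Qed.

(** For [k > N] the entry bound is summed crudely over [n^2] pairs. Since [1 <= n eps], this is at
    most [n^3 eps (b t)^k], and [n <= b^k] absorbs the cube: three more powers of [b]. *)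
Lemma bilinear_power_le (x y : 'cV[R]_n) (eps : R) k :
  (forall i, `|x i 0| <= 1) -> (forall i, `|y i 0| <= 1) ->
  1 <= n%:R * eps ->
  (forall k, (0 < k <= N)%N -> `|(x^T *m A ^+ k *m y) 0 0| <= eps * t ^+ k) ->
  (0 < k)%N -> `|(x^T *m A ^+ k *m y) 0 0| <= eps * (b ^+ 4 * t) ^+ k.
Proof.
move=> x1 y1 neps H k0.
have b0 : 0 <= b by exact: le_trans b1.
have n0' : 0 < (n%:R : R) by rewrite ltr0n.
have eps0 : 0 <= eps.
  by rewrite -(pmulr_rge0 _ n0') (le_trans ler01).
have [kN|Nk] := leqP k N.
  rewrite (le_trans (H k _)) ?k0// ler_wpM2l// lerXn2r ?nnegrE ?mulr_ge0 ?exprn_ge0//.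
  by rewrite ler_peMl// exprn_ege1.
apply: (@le_trans _ _ (\sum_(j < n) \sum_(i < n) (b * t) ^+ k)).
  rewrite mxE (le_trans (ler_norm_sum _ _ _))//; apply: ler_sum => j _.
  rewrite mxE normrM (le_trans (ler_piMr _ (y1 j)))//.
  rewrite (le_trans (ler_norm_sum _ _ _))//; apply: ler_sum => i _.
  by rewrite mxE normrM (le_trans (ler_piMl _ (x1 i)))// entry_power_le.
rewrite !sumr_const !card_ord.
rewrite (_ : _ *+ n *+ n = n%:R * (n%:R * (b * t) ^+ k)); last by rewrite !mulr_natl.
have bk : 0 <= (b * t) ^+ k by rewrite exprn_ge0// mulr_ge0.
have -> : (b ^+ 4 * t) ^+ k = (b ^+ k) ^+ 3 * (b * t) ^+ k.
  rewrite exprMn [(b * t) ^+ k]exprMn mulrA -[b ^+ 4 ^+ k]exprM -[b ^+ k ^+ 3]exprM -exprD.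
  by congr (b ^+ _ * _); lia.
rewrite [leLHS]mulrA [leRHS]mulrA ler_wpM2r//.
have nbk : n%:R <= b ^+ k by rewrite (le_trans nb)// ler_weXn2l// ltnW.
apply: (@le_trans _ _ (eps * n%:R ^+ 3)).
  have -> : eps * n%:R ^+ 3 = n%:R * n%:R * (n%:R * eps) by ring.
  by rewrite ler_peMr// mulr_ge0// ltW.
by rewrite ler_wpM2l// lerXn2r ?nnegrE ?ler0n// exprn_ge0.
Qed.

End Powers.

(** * Truncation of the noise *)

Definition truncate (R : realType) (B x : R) : R := if `|x| <= B then x else 0.

Section Truncation.
Local Open Scope classical_set_scope.
Context d (T : measurableType d) (R : realType) (P : probability T R).
Variables (X : {RV P >-> R}) (B sigma : R).
Hypothesis B0 : 0 <= B.

Lemma truncate_le (x : R) : `|truncate B x| <= B.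
Proof. by rewrite /truncate; case: ifP => //; rewrite normr0. Qed.

Lemma bmeas_truncate : bmeas (truncate B).
Proof.
split; last by exists B; exact: truncate_le.
have -> : truncate B = (fun x => x * \1_`[- B, B] x).
  apply/funext => x; rewrite /truncate ler_norml indicE mem_setE in_itv /=.
  by case: ifP; rewrite ?mulr1 ?mulr0.
apply: measurable_funM => //; exact: measurable_indic.
Qed.

(** In the bounded case truncation changes [X] on a null set only. In the symmetric case
    [truncate B] is odd, so the truncated mean equals its own opposite. *)
Lemma Ex_truncate :
  ('E_P[X] = 0)%E ->
  {ae P, forall w, `|X w| <= B} \/ symmetric_distribution X ->
  Ex P (fun w => truncate B (X w)) = 0.
Proof.
move=> EX0; have mX : measurable_fun [set: T] X by [].
have bt := bmeas_comp bmeas_truncate mX.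
case=> [Xae|Xsym].
  rewrite /Ex /Rintegral -[RHS]/(fine 0%E) -EX0 unlock; congr fine.
  apply: ae_eq_integral => //.
  - have [mbt _] := bt; exact/measurable_EFinP.
  - exact/measurable_EFinP.
  - apply: filterS Xae => w XB _; by rewrite /truncate XB.
have mNX : measurable_fun [set: T] (fun w => - X w) by exact: measurableT_comp.
have Ex1 (f : T -> R) : Ex P (fun w => f w * 1) = Ex P f.
  by congr (Ex P _); apply/funext => w; rewrite mulr1.
have := @Ex_indic_ext _ _ _ P (truncate B) X (fun w => - X w) (fun=> 1) (fun=> 1) 1
  mX mNX (bmeas_cst _ 1) (bmeas_cst _ 1) bmeas_truncate.
rewrite !(Ex1 (fun w => truncate B _)) mul1r => H.
have e : Ex P (fun w => truncate B (- X w)) = - Ex P (fun w => truncate B (X w)).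
  rewrite -mulN1r -ExZ//; congr (Ex P _); apply/funext => w.
  by rewrite /truncate normrN mulN1r; case: ifP => //; rewrite oppr0.
suff : Ex P (fun w => truncate B (X w)) = - Ex P (fun w => truncate B (X w)) by lra.
rewrite -e; apply: H => A mA; rewrite mul1r !(Ex1 (fun w => \1_A _)).
have m1 : measurable (X @^-1` A) by rewrite -[X in measurable X]setTI; exact: mX.
have m2 : measurable ((fun w => - X w) @^-1` A).
  by rewrite -[X in measurable X]setTI; exact: mNX.
rewrite -[LHS]/(Ex P (\1_(X @^-1` A))) -[RHS]/(Ex P (\1_((fun w => - X w) @^-1` A))).
by rewrite !Ex_indic// Xsym.
Qed.

Lemma Ex_truncate_sqr :
  ('E_P[X] = 0)%E -> ('V_P[X] <= (sigma ^+ 2)%:E)%E ->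
  Ex P (fun w => truncate B (X w) ^+ 2) <= sigma ^+ 2.
Proof.
move=> EX0 VX; have mX : measurable_fun [set: T] X by [].
have bt := bmeasX 2 (bmeas_comp bmeas_truncate mX).
rewrite -lee_fin /Ex /Rintegral fineK; last first.
  by apply: integrable_fin_num => //; exact: bmeas_integrable.
apply: le_trans VX.
rewrite /variance covariance.unlock EX0 /= expectation.unlock.
apply: ge0_le_integral => //.
- by move=> w _; rewrite lee_fin sqr_ge0.
- have [mbt _] := bt; exact/measurable_EFinP.
- have mX0 : measurable_fun [set: T] (fun w => X w - 0).
    by apply: measurable_funB => //; exact: measurable_cst.
  by have := measurable_funM mX0 mX0 => mXX; exact/measurable_EFinP.
move=> w _ /=; rewrite !fctE /= subr0 lee_fin -expr2 /truncate.
by case: ifP => // _; rewrite expr0n sqr_ge0.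
Qed.

End Truncation.

(** * The truncated block noise matrix *)

Section NoiseMatrix.
Context d (T : measurableType d) (R : realType) (P : probability T R).
Variables (n1 n2 : nat) (H1 H2 : rmatrix P n1 n2).
Local Notation entry := (('I_n1 * 'I_n2) + ('I_n1 * 'I_n2))%type.

(** The sum type merges the entries of both matrices into one family, about which a single
    independence statement can be made. *)
Definition noise_entry (s : entry) : T -> R :=
  match s with inl ij => H1 ij | inr ij => H2 ij end.

Definition entry_position (s : entry) : 'I_(n1 + n2) * 'I_(n1 + n2) :=
  match s with
  | inl ij => (lshift n2 ij.1, rshift n1 ij.2)
  | inr ij => (rshift n1 ij.2, lshift n2 ij.1)
  end.

Definition truncated_noise (B : R) (w : T) : 'M[R]_(n1 + n2) :=
  block_mx 0 (\matrix_(i, j) truncate B (H1 (i, j) w))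
           (\matrix_(i, j) truncate B (H2 (i, j) w))^T 0.

Lemma measurable_noise_entry s : measurable_fun [set: T]%classic (noise_entry s).
Proof. by case: s => ij /=. Qed.

(** For each matrix the event that all entries lie in given sets belongs to its generated
    sigma-algebra and has product probability; [independent_families] multiplies the two. *)
Lemma independent_entries : mutually_independent H1 -> mutually_independent H2 ->
  independent_families H1 H2 ->
  forall A : entry -> set R, (forall s, measurable (A s)) ->
  Ex P (fun w => \prod_s \1_(A s) (noise_entry s w)) =
  \prod_s Ex P (fun w => \1_(A s) (noise_entry s w)).
Proof.
move=> ind1 ind2 ind12 A mA.
have prob (H : rmatrix P n1 n2) (A' : 'I_n1 * 'I_n2 -> set R) :
    mutually_independent H -> (forall ij, measurable (A' ij)) ->
    let E := (\bigcap_(ij in [set` [set: 'I_n1 * 'I_n2]%SET]) H ij @^-1` A' ij)%classic in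
    [/\ sigma_of H E, measurable E,
     (forall w, \1_E w = \prod_ij \1_(A' ij) (H ij w) :> R) &
     fine (P E) = \prod_ij Ex P (fun w => \1_(A' ij) (H ij w))].
  move=> indH mA' E.
  have mpre ij : measurable (H ij @^-1` A' ij)%classic.
    by rewrite -[X in measurable X]setTI; apply: measurable_funPT.
  split.
  - have : @measurable _ (g_sigma_algebraType
      (\bigcup_(i in [set: 'I_n1 * 'I_n2]) g_sigma_algebra_preimage (H i)))%classic E.
      apply: fin_bigcap_measurable; first exact: finite_finset.
      move=> ij _; apply: sub_gen_smallest; exists ij => //.
      by exists (A' ij) => //; rewrite setTI.
    by [].
  - by apply: fin_bigcap_measurable; first exact: finite_finset.
  - move=> w; rewrite indicE; have [Ew|nEw] := pselect (E w).
      rewrite mem_set// big1// => ij _; rewrite indicE mem_set//.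
      by apply: (Ew ij) => /=; rewrite inE.
    rewrite memNset//.
    have [ij nij] : exists ij, ~ A' ij (H ij w).
      apply: contrapT => nA; apply: nEw => ij _ /=; apply: contrapT => n'.
      by apply: nA; exists ij.
    by rewrite (bigD1 ij)//= indicE memNset// mul0r.
  - rewrite /E (indH [set: 'I_n1 * 'I_n2]%SET)//.
    rewrite (eq_bigr (fun ij => (Ex P (fun w => \1_(A' ij) (H ij w)))%:E)).
      by rewrite prodEFin /=; apply: eq_bigl => ij; rewrite inE.
    move=> ij _; rewrite -[X in Ex P X]/(\1_(H ij @^-1` A' ij)%classic : T -> R).
    by rewrite Ex_indic// fineK// fin_num_measure.
have [s1 m1 i1 p1] := prob H1 (fun ij => A (inl ij)) ind1 (fun ij => mA (inl ij)).
have [s2 m2 i2 p2] := prob H2 (fun ij => A (inr ij)) ind2 (fun ij => mA (inr ij)).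
rewrite [RHS]big_sumType /= -p1 -p2.
have -> : (fun w => \prod_s \1_(A s) (noise_entry s w)) =
  \1_(\bigcap_(ij in [set` [set: 'I_n1 * 'I_n2]%SET]) H1 ij @^-1` A (inl ij) `&`
  \bigcap_(ij in [set` [set: 'I_n1 * 'I_n2]%SET]) H2 ij @^-1` A (inr ij))%classic :> (T -> R).
  by apply/funext => w; rewrite big_sumType /= -i1 -i2 indicI.
by rewrite Ex_indic ?ind12//; [rewrite fineM// fin_num_measure|exact: measurableI].
Qed.

Lemma prod_positions (f : 'I_(n1 + n2) * 'I_(n1 + n2) -> R) :
  \prod_e f e =
  (\prod_i \prod_j f (lshift n2 i, lshift n2 j)) *
  (\prod_i \prod_j f (rshift n1 i, rshift n1 j)) *
  \prod_s f (entry_position s).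
Proof.
have pairs (I J : finType) (g : I * J -> R) : \prod_p g p = \prod_i \prod_j g (i, j).
  by rewrite pair_big; apply: eq_bigr => -[].
rewrite big_sumType /= !pairs big_split_ord /=.
under eq_bigr do rewrite big_split_ord.
under [X in _ * X]eq_bigr do rewrite big_split_ord.
rewrite !big_split /= [X in _ = _ * (_ * X)]exchange_big /=.
ring.
Qed.

Variable B : R.
Local Notation h := (fun i j w => truncated_noise B w i j).

Lemma truncated_noise_position s w :
  truncated_noise B w (entry_position s).1 (entry_position s).2 =
  truncate B (noise_entry s w).
Proof.
rewrite /truncated_noise; case: s => -[i j] /=.
  by rewrite block_mxEur mxE.
by rewrite block_mxEdl !mxE.
Qed.

Lemma truncated_noise_cases i j :
  (forall w, truncated_noise B w i j = 0) \/
  exists s, forall w, truncated_noise B w i j = truncate B (noise_entry s w).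
Proof.
rewrite /truncated_noise; case: (split_ordP i) => i' ->; case: (split_ordP j) => j' ->.
- by left => w; rewrite block_mxEul mxE.
- by right; exists (inl (i', j')) => w; rewrite block_mxEur mxE.
- by right; exists (inr (j', i')) => w; rewrite block_mxEdl !mxE.
- by left => w; rewrite block_mxEdr mxE.
Qed.

Hypothesis B0 : 0 <= B.

Lemma bmeas_truncated_noise i j : bmeas (h i j).
Proof.
case: (truncated_noise_cases i j) => [z|[s e]].
  rewrite (_ : h i j = fun=> 0); first exact: bmeas_cst.
  by apply/funext.
rewrite (_ : h i j = fun w => truncate B (noise_entry s w)); last exact/funext.
exact: (bmeas_comp (bmeas_truncate B0) (measurable_noise_entry s)).
Qed.

Lemma truncated_noise_le i j w : `|h i j w| <= B.
Proof.
case: (truncated_noise_cases i j) => [->|[s ->]]; first by rewrite normr0.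
exact: truncate_le.
Qed.

Lemma Ex_truncated_noise cb sigma :
  noise_assumption cb sigma B H1 -> noise_assumption cb sigma B H2 ->
  forall i j, Ex P (h i j) = 0 /\ Ex P (fun w => h i j w ^+ 2) <= sigma ^+ 2.
Proof.
move=> N1 N2 i j; case: (truncated_noise_cases i j) => [z|[s e]].
  rewrite (_ : h i j = fun=> 0); last exact/funext.
  have -> : (fun w => truncated_noise B w i j ^+ 2) = (fun=> 0).
    by apply/funext => w; rewrite z expr0n.
  by rewrite !Ex_cst sqr_ge0.
rewrite (_ : h i j = fun w => truncate B (noise_entry s w)); last exact/funext.
have -> : (fun w => truncated_noise B w i j ^+ 2) =
   (fun w => truncate B (noise_entry s w) ^+ 2) by apply/funext => w; rewrite e.
case: s {e} => ij /=; split.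
- apply: Ex_truncate => //; first exact: noise_centered N1 ij.
  by case: (noise_tail N1 ij) => [|[]]; [left|right].
- by apply: Ex_truncate_sqr => //; [exact: noise_centered N1 ij|exact: noise_variance N1 ij].
- apply: Ex_truncate => //; first exact: noise_centered N2 ij.
  by case: (noise_tail N2 ij) => [|[]]; [left|right].
- by apply: Ex_truncate_sqr => //; [exact: noise_centered N2 ij|exact: noise_variance N2 ij].
Qed.

Lemma Ex_prod_truncated_noise :
  mutually_independent H1 -> mutually_independent H2 ->
  independent_families H1 H2 ->
  forall m : 'I_(n1 + n2) * 'I_(n1 + n2) -> nat,
    Ex P (fun w => \prod_e h e.1 e.2 w ^+ m e) =
    \prod_e Ex P (fun w => h e.1 e.2 w ^+ m e).
Proof.
move=> ind1 ind2 ind12 m.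
have bt s : bmeas (fun w => truncate B (noise_entry s w)).
  exact: (bmeas_comp (bmeas_truncate B0) (measurable_noise_entry s)).
have := independent_Ex (measurable_noise_entry) (independent_entries ind1 ind2 ind12)
  (fun s => bmeasX (m (entry_position s)) (bmeas_truncate B0)).
move=> ind; rewrite prod_positions.
(* The zero diagonal blocks contribute a constant, not necessarily [0]: a vanishing exponent gives
   [0 ^+ 0 = 1]. *)
pose K := (\prod_(i < n1) \prod_(j < n1) (0 : R) ^+ m (lshift n2 i, lshift n2 j)) *
  (\prod_(i < n2) \prod_(j < n2) (0 : R) ^+ m (rshift n1 i, rshift n1 j)).
have -> : (fun w => \prod_e h e.1 e.2 w ^+ m e) =
  (fun w => K * \prod_s truncate B (noise_entry s w) ^+ m (entry_position s)).
  apply/funext => w; rewrite prod_positions; congr (_ * _ * _).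
  - apply: eq_bigr => i _; apply: eq_bigr => j _ /=.
    by rewrite /truncated_noise block_mxEul mxE.
  - apply: eq_bigr => i _; apply: eq_bigr => j _ /=.
    by rewrite /truncated_noise block_mxEdr mxE.
  - by apply: eq_bigr => s _; rewrite truncated_noise_position.
rewrite ExZ; last by apply: bmeas_prod => s; exact: bmeasX.
rewrite ind; congr (_ * _ * _).
- apply: eq_bigr => i _; apply: eq_bigr => j _ /=.
  rewrite -[LHS](Ex_cst P); congr (Ex P _); apply/funext => w.
  by rewrite /truncated_noise block_mxEul mxE.
- apply: eq_bigr => i _; apply: eq_bigr => j _ /=.
  rewrite -[LHS](Ex_cst P); congr (Ex P _); apply/funext => w.
  by rewrite /truncated_noise block_mxEdr mxE.
- apply: eq_bigr => s _; congr (Ex P _); apply/funext => w.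
  by rewrite truncated_noise_position.
Qed.

Lemma noise_entry_tail cb sigma s :
  noise_assumption cb sigma B H1 -> noise_assumption cb sigma B H2 -> 0 < cb ->
  (P [set w | (B < `|noise_entry s w|)%R]%classic <= (cb * (n1 + n2)%:R ^- 12)%:E)%E.
Proof.
move=> N1 N2 cb0.
have aux (X : {RV P >-> R}) : {ae P, forall w, `|X w| <= B} \/
    (symmetric_distribution X /\
     (P [set w | (B < `|X w|)%R]%classic <= (cb * (n1 + n2)%:R ^- 12)%R%:E)%E) ->
   (P [set w | (B < `|X w|)%R]%classic <= (cb * (n1 + n2)%:R ^- 12)%:E)%E.
  case=> [XB|[]//].
  have mA : measurable [set w | (B < `|X w|)%R]%classic by apply: measurable_normr_gt.
  have -> : P [set w | (B < `|X w|)%R]%classic = 0%E.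
    apply/negligibleP => //; apply: negligibleS XB => w /= Bw.
    by apply/negP; rewrite -ltNge.
  by rewrite lee_fin mulr_ge0 ?(ltW cb0)// invr_ge0 exprn_ge0.
by case: s => ij /=; apply: aux; [exact: noise_tail N1 ij|exact: noise_tail N2 ij].
Qed.

End NoiseMatrix.

(** * Conclusion *)

Lemma with_probability_mono d (T : measurableType d) (R : realType)
    (P : probability T R) (p p' : R) (Q Q' : T -> Prop) :
  p' <= p -> (forall w, Q w -> Q' w) ->
  with_probability_at_least P p Q -> with_probability_at_least P p' Q'.
Proof.
move=> pp QQ [E [mE pE EQ]]; exists E; split => //; last by move=> w /EQ /QQ.
by apply: le_trans pE; rewrite lee_fin.
Qed.

(** Total cost of the moment tails: [N] exponents, each with [n^2] entries and [4] pairs from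
    [{a, b}]. With [N <= 3 n] and [n^2 + 4 <= 2 n^2] it is at most [6 n^-13], which is then
    weakened. *)
Lemma log_steps_count (R : realType) n : (1 < n)%N ->
  (log_steps R n)%:R * ((n * n)%:R + 4) * n%:R ^- 16 <= 6 * n%:R ^- 10 :> R.
Proof.
move=> n1; have hN := @log_steps_ub R n n1.
have x2 : 2 <= n%:R :> R by rewrite ler_nat.
have lx : ln (n%:R : R) <= n%:R.
  by rewrite -ler_expR lnK ?posrE ?(lt_le_trans _ x2)// (le_trans _ (expR_ge1Dx _))// lerDr.
rewrite natrM; set x : R := n%:R in hN x2 lx *.
have x0 : 0 < x by lra.
have a1 : (log_steps R n)%:R <= 3 * x by lra.
have a2 : x * x + 4 <= 2 * (x * x) by nra.
have -> : x ^- 16 = x ^- 10 * x ^- 6 by rewrite -invfM -exprD.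
rewrite mulrA mulrAC ler_wpM2r ?invr_ge0 ?exprn_ge0 ?(ltW x0)//.
rewrite ler_pdivrMr ?exprn_gt0//.
apply: (@le_trans _ _ (3 * x * (2 * (x * x)))).
  by rewrite ler_pM// addr_ge0// mulr_ge0 ?(ltW x0).
have -> : 3 * x * (2 * (x * x)) = 6 * x ^+ 3 by ring.
by rewrite ler_wpM2l// ler_weXn2l//; lra.
Qed.

Lemma double_mul_le_sqr n1 n2 : ((n1 * n2).*2 <= (n1 + n2) * (n1 + n2))%N.
Proof. nia. Qed.

(** * The event on which the deterministic argument runs *)

Section GoodEvent.
Context d (T : measurableType d) (R : realType) (P : probability T R).
Variables (n1 n2 : nat) (H1 H2 : rmatrix P n1 n2) (cb sigma B L eps : R).
Variables (a b : 'cV[R]_(n1 + n2)).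
Local Notation n := (n1 + n2)%N.
Local Notation N := (log_steps R n).
Local Notation entry := (('I_n1 * 'I_n2) + ('I_n1 * 'I_n2))%type.
Local Notation t := (24 * expR 1 ^+ 8 * L).

(** The first clause makes truncation harmless; the other two are the inputs of [entry_power_le] and
    [bilinear_power_le]. *)
Definition good_noise w : Prop :=
  [/\ forall s : entry, `|noise_entry H1 H2 s w| <= B,
   forall k i j, (0 < k <= N)%N -> `|(truncated_noise H1 H2 B w ^+ k) i j| <= t ^+ k
   & forall x y, x \in [:: a; b] -> y \in [:: a; b] -> forall k, (0 < k <= N)%N ->
     `|form (truncated_noise H1 H2 B w) x y k| <= eps * t ^+ k].

Lemma good_event :
  0 < cb -> (1 < n)%N -> 0 <= sigma -> 0 < B -> 0 < L -> 0 < eps ->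
  noise_assumption cb sigma B H1 -> noise_assumption cb sigma B H2 ->
  independent_families H1 H2 ->
  sigma ^+ 2 * (n%:R * ln n%:R) <= L ^+ 2 -> B * ln n%:R <= L ->
  \sum_i a i 0 ^+ 2 <= 1 -> (forall i, `|a i 0| <= eps) ->
  \sum_i b i 0 ^+ 2 <= 1 -> (forall i, `|b i 0| <= eps) ->
  with_probability_at_least P (1 - (cb + 6) * n%:R ^- 10) good_noise.
Proof.
move=> cb0 n_gt1 s0 B0 L0 eps0 N1 N2 ind Ls LB a2 ae b2 be.
pose h i j w : R := truncated_noise H1 H2 B w i j.
have B0' := ltW B0.
have bh i j : bmeas (h i j) := bmeas_truncated_noise H1 H2 B0' i j.
have tail := fun eta x y k => @bilinear_tail _ _ _ P n h sigma B L eta x y k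
  (fun i j => (bh i j).1) (truncated_noise_le H1 H2 B0')
  (Ex_prod_truncated_noise B0' (noise_independent N1) (noise_independent N2) ind)
  (fun i j => (Ex_truncated_noise B0' N1 N2 i j).1)
  (fun i j => (Ex_truncated_noise B0' N1 N2 i j).2) n_gt1 s0 B0' L0 Ls LB.
have rmatE w : rmat h w = truncated_noise H1 H2 B w.
  by apply/matrixP => i j; rewrite mxE.
pose J := ((('I_N * ('I_n * 'I_n)) + ('I_N * (bool * bool))) + entry)%type.
pose ab (c : bool) := if c then a else b.
(* Entries of a power are bilinear forms in basis vectors, so they fall under [bilinear_tail] with
   [eta = 1]. *)
pose S (s : J) : set T := match s with
  | inl (inl (k, (i, j))) => [set w | (1 * t ^+ k.+1 <
      `|((delta_mx i 0 : 'cV[R]_(n1 + n2))^T *m rmat h w ^+ k.+1 *m (delta_mx j 0 : 'cV[R]_(n1 + n2))) 0 0|)%R]%classic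
  | inl (inr (k, (x, y))) => [set w | (eps * t ^+ k.+1 <
      `|((ab x)^T *m rmat h w ^+ k.+1 *m ab y) 0 0|)%R]%classic
  | inr s => [set w | (B < `|noise_entry H1 H2 s w|)%R]%classic
  end.
pose c (s : J) : R := match s with inl _ => n%:R ^- 16 | inr _ => cb * n%:R ^- 12 end.
have mS s : measurable (S s).
  case: s => [[[k [i j]]|[k [x y]]]|s] /=; apply: measurable_normr_gt.
  - by case: (bmeas_bilinear (fun i j => (bh i j).1) (truncated_noise_le H1 H2 B0') (delta_mx i 0) (delta_mx j 0) k.+1).
  - by case: (bmeas_bilinear (fun i j => (bh i j).1) (truncated_noise_le H1 H2 B0') (ab x) (ab y) k.+1).
  - exact: measurable_noise_entry.
have Sc s : (P (S s) <= (c s)%:E)%E.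
  case: s => [[[k [i j]]|[k [x y]]]|s] /=.
  - apply: tail => // [|j'].
      rewrite (bigD1 i)//= !mxE !eqxx expr1n big1 ?addr0// => i' /negbTE ii'.
      by rewrite mxE ii' expr0n.
    by rewrite mxE; case: (_ && _); rewrite ?normr1 ?normr0.
  - by apply: tail => //; [case: x|case: y].
  - exact: (noise_entry_tail s N1 N2).
apply: with_probability_mono (union_bound mS Sc); last first.
  move=> w Hw; split.
  - by move=> s; rewrite leNgt; apply/negP; exact: (Hw (inr s)).
  - case=> // k i j /andP[_ kN].
    have := Hw (inl (inl (Ordinal kN, (i, j)))) => /= /negP; rewrite -leNgt mul1r rmatE.
    by rewrite trmx_delta -rowE -colE !mxE.
  - move=> x y xab yab; case=> // k /andP[_ kN].
    have abE z : z \in [:: a; b] -> exists c, z = ab c.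
      by rewrite !inE => /orP[] /eqP ->; [exists true|exists false].
    have [x' ->] := abE _ xab; have [y' ->] := abE _ yab.
    have := Hw (inl (inr (Ordinal kN, (x', y')))) => /= /negP; rewrite -leNgt.
    by rewrite rmatE.
rewrite lerD2l lerN2 !big_sumType /= !sumr_const !card_prod !card_ord card_bool.
have cnt := @log_steps_count R n n_gt1.
have n0 : 0 < (n%:R : R) by rewrite ltr0n (ltn_trans _ n_gt1).
have -> : n%:R ^- 16 *+ (N * (n * n)) + n%:R ^- 16 *+ (N * (2 * 2)) =
    N%:R * ((n * n)%:R + 4) * n%:R ^- 16 :> R.
  by rewrite -mulrnDr -[LHS]mulr_natl -mulnDr natrM natrD.
have -> : cb * n%:R ^- 12 *+ (n1 * n2) + cb * n%:R ^- 12 *+ (n1 * n2) =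
    (n1 * n2).*2%:R * (cb * n%:R ^- 12) by rewrite -mulrnDr addnn mulr_natl.
rewrite addrC mulrDl lerD//.
rewrite mulrCA ler_wpM2l ?(ltW cb0)//.
have -> : n%:R ^- 12 = n%:R ^- 10 * n%:R ^- 2 :> R by rewrite -invfM -exprD.
rewrite mulrCA ler_piMr ?invr_ge0 ?exprn_ge0 ?(ltW n0)//.
rewrite ler_pdivrMr ?exprn_gt0// mul1r -natrX ler_nat -mulnn.
exact: double_mul_le_sqr.
Qed.

End GoodEvent.

Lemma l2norm1_sum (R : realType) m (x : 'cV[R]_m) :
  l2norm x = 1 -> \sum_i x i 0 ^+ 2 = 1.
Proof.
move=> h; rewrite -[LHS]sqr_sqrtr; last by apply: sumr_ge0 => i _; exact: sqr_ge0.
by rewrite -/(l2norm x) h expr1n.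
Qed.

Lemma l2norm1_entry (R : realType) m (x : 'cV[R]_m) i :
  l2norm x = 1 -> `|x i 0| <= 1.
Proof.
move=> /l2norm1_sum h; rewrite -(@expr_le1 _ 2)// real_normK ?num_real//.
by rewrite -h (bigD1 i)//= lerDl sumr_ge0// => j _; rewrite sqr_ge0.
Qed.

(** * Consequences of incoherence *)

Section Incoherence.
Variables (R : realType) (n1 n2 : nat) (u : 'cV[R]_n1) (v : 'cV[R]_n2) (mu : R).
Hypotheses (hu : l2norm u = 1) (hv : l2norm v = 1)
  (hmu : incoherence_parameter u v mu).
Local Notation eps := (Num.sqrt 2 * Num.sqrt (mu / (n1 + n2)%:R)).

Let s2 : 0 < Num.sqrt 2 :> R.
Proof. by rewrite sqrtr_gt0. Qed.

Lemma incoherent_entry :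
  (forall i, `|u i 0| <= eps) /\ (forall j, `|v j 0| <= eps).
Proof.
have [_ h] := hmu.1; split=> [i|j].
  have [+ _] := h (lshift n2 i); rewrite mxE col_mxEu normrM ger0_norm ?invr_ge0 ?(ltW s2)//.
  by rewrite mulrC ler_pdivrMr// mulrC.
have [+ _] := h (rshift n1 j); rewrite mxE col_mxEd normrM ger0_norm ?invr_ge0 ?(ltW s2)//.
by rewrite mulrC ler_pdivrMr// mulrC.
Qed.

Lemma unit_dim_gt0 m (x : 'cV[R]_m) : l2norm x = 1 -> (0 < m)%N.
Proof.
case: m x => // x /l2norm1_sum; rewrite big_ord0 => /eqP.
by rewrite eq_sym oner_eq0.
Qed.

Lemma incoherence_dim : (1 < n1 + n2)%N.
Proof. have := unit_dim_gt0 hu; have := unit_dim_gt0 hv; lia. Qed.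

(** By minimality of [mu]: unit vectors have entries at most [1], so [n] is an admissible bound,
    [mu <= n], and [eps <= sqrt 2]. *)
Lemma incoherence_le : eps <= 2.
Proof.
have n0 : 0 < ((n1 + n2)%:R : R) by rewrite ltr0n (ltn_trans _ incoherence_dim).
have mun : mu <= (n1 + n2)%:R.
  apply: hmu.2; split=> [|k]; first exact: ltW.
  have s1 : (Num.sqrt 2)^-1 <= 1 :> R.
    by rewrite invf_le1// -[leLHS]sqrtr1 ler_wsqrtr//; lra.
  have scaled (x : 'cV[R]_(n1 + n2)) :
      `|x k 0| <= 1 -> `|((Num.sqrt 2)^-1 *: x) k 0| <= 1.
    move=> xk; rewrite mxE normrM mulr_ile1// ger0_norm// invr_ge0 (ltW s2)//.
  rewrite divff ?gt_eqF// sqrtr1.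
  by split; apply: scaled; case: (split_ordP k) => i ->;
    rewrite ?col_mxEu ?col_mxEd ?mxE ?normrN l2norm1_entry.
rewrite -[leRHS]ger0_norm// -sqrtr_sqr -sqrtrM// ler_wsqrtr//.
rewrite expr2 ler_wpM2l// ler_pdivrMr//; lra.
Qed.

(** A unit vector cannot have all entries small: [1 = |u|^2 <= n1 eps^2 <= n eps^2]. *)
Lemma incoherence_ge : 0 < eps /\ 1 <= (n1 + n2)%:R * eps.
Proof.
have n0 : 1 <= ((n1 + n2)%:R : R) by rewrite ler1n ltnW// incoherence_dim.
have e0 : 0 <= eps by rewrite mulr_ge0 ?sqrtr_ge0.
have sq : 1 <= (n1 + n2)%:R * eps ^+ 2.
  rewrite -[leLHS](l2norm1_sum hu).
  apply: (@le_trans _ _ (\sum_(i < n1) eps ^+ 2)).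
    apply: ler_sum => i _; rewrite -[leLHS]real_normK ?num_real//.
    by rewrite lerXn2r ?nnegrE ?e0// incoherent_entry.1.
  rewrite sumr_const card_ord -[_ *+ n1]mulr_natl ler_wpM2r ?sqr_ge0//.
  by rewrite ler_nat leq_addr.
have le1 : 1 <= (n1 + n2)%:R * eps.
  rewrite -(@expr_ge1 _ 2) ?mulr_ge0 ?ler0n// exprMn (le_trans sq)//.
  by rewrite ler_wpM2r ?sqr_ge0// expr2 ler_peMl ?ler0n.
split=> //; rewrite lt_neqAle e0 andbT eq_sym; apply/negP => /eqP e.
by move: le1; rewrite e mulr0 ler10.
Qed.

End Incoherence.

Local Open Scope classical_set_scope.
Local Open Scope complex_scope.
Local Open Scope ring_scope.

Theorem corollary8 (R : realType) (cb : R) (hcb : 0 < cb) :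
  exists c1 C C' : R,
    [/\ 0 < c1, 0 < C & 0 < C'] /\
    forall (n1 n2 : nat) (lambda : R) (u : 'cV[R]_n1) (v : 'cV[R]_n2) (mu : R)
      (sigma B : R)
      (d : measure_display) (T : measurableType d) (P : probability T R)
      (H1 H2 : rmatrix P n1 n2),
    let n := (n1 + n2)%N in
    let Mstar : 'M[R]_(n1, n2) := lambda *: (u *m v^T) in
    let M1 := fun w : T => Mstar + rmx_at H1 w in
    let M2 := fun w : T => Mstar + rmx_at H2 w in
    let Md := fun w : T => block_mx 0 (M1 w) (M2 w)^T 0 : 'M[R]_(n1 + n2) in
    0 < lambda -> l2norm u = 1 -> l2norm v = 1 ->
    incoherence_parameter u v mu ->
    0 <= sigma -> 0 < B ->
    noise_assumption cb sigma B H1 -> noise_assumption cb sigma B H2 ->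
    independent_families H1 H2 ->
    noise_level n sigma B / lambda <= c1 ->
    with_probability_at_least P (1 - C' * n%:R ^- 10) (fun w =>
      forall l1 l2 : R[i], leading_eigenvalues (Md w) l1 l2 ->
        Num.max (normc (l1 - lambda%:C)) (normc (l2 + lambda%:C))
          <= C * noise_level n sigma B * Num.sqrt (mu / n%:R)).
Proof.
(* [K * L] will be [rho]: [24 * e^8] comes from the tail bound and [e^4] from the passage to all
   powers. *)
pose K : R := 24 * expR 1 ^+ 12.
have K0 : 0 < K by rewrite mulr_gt0 ?exprn_gt0 ?expR_gt0.
(* The first witness turns the hypothesis into [800 * rho <= lambda]. In the second, [28] comes from
   the spectral bound and [Num.sqrt 2] from passing from the normalized eigenvectors to [u] and [v].
   In the third, [cb] pays for truncation and [6] for the moment tails. *)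
exists (800 * K)^-1, (28 * (Num.sqrt 2 * K)), (cb + 6); split.
  have r2 : 0 < Num.sqrt 2 :> R by rewrite sqrtr_gt0 ltr0n.
  split; last by apply: addr_gt0 => //; rewrite ltr0n.
    by rewrite invr_gt0; apply: mulr_gt0; [rewrite ltr0n|exact: K0].
  by apply: mulr_gt0; [rewrite ltr0n|exact: mulr_gt0].
move=> n1 n2 lam u v mu sigma B d T P H1 H2 n Mstar M1 M2 Md lam0 hu hv hmu s0 B0 N1 N2 ind hc.
set L := noise_level n sigma B in hc *.
set eps := Num.sqrt 2 * Num.sqrt (mu / n%:R).
have n_gt1 : (1 < n)%N := incoherence_dim hu hv.
have [eps0 neps] : 0 < eps /\ 1 <= n%:R * eps := incoherence_ge hu hv hmu.
have eps2 : eps <= 2 := incoherence_le hu hv hmu.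
have [ue ve] := incoherent_entry hmu; rewrite -/n -/eps in ue ve.
have ln0 : 0 < ln (n%:R : R) by rewrite ln_gt0// ltr1n.
have BL : B * ln n%:R <= L by rewrite /L /noise_level le_max lexx orbT.
have L0 : 0 < L by rewrite (lt_le_trans _ BL)// mulr_gt0.
have sL : sigma ^+ 2 * (n%:R * ln n%:R) <= L ^+ 2.
  have nl : 0 <= n%:R * ln (n%:R : R) by rewrite mulr_ge0 ?ler0n ?(ltW ln0).
  rewrite -[X in _ * X]sqr_sqrtr// -exprMn lerXn2r ?nnegrE ?mulr_ge0 ?sqrtr_ge0 ?(ltW L0)//.
  by rewrite /L /noise_level le_max lexx.
pose a : 'cV[R]_n := col_mx u 0; pose b : 'cV[R]_n := col_mx 0 v.
have aE : (forall i, `|a (lshift n2 i) 0| = `|u i 0|) * (forall i, a (rshift n1 i) 0 = 0).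
  by split=> i; rewrite ?col_mxEu ?col_mxEd ?mxE.
have bE : (forall i, b (lshift n2 i) 0 = 0) * (forall i, `|b (rshift n1 i) 0| = `|v i 0|).
  by split=> i; rewrite ?col_mxEu ?col_mxEd ?mxE.
have ae i : `|a i 0| <= eps.
  by case: (split_ordP i) => j ->; rewrite ?aE// normr0 ltW.
have be i : `|b i 0| <= eps.
  by case: (split_ordP i) => j ->; rewrite ?bE// normr0 ltW.
have a1 i : `|a i 0| <= 1.
  by case: (split_ordP i) => j ->; rewrite ?aE ?normr0// l2norm1_entry.
have b1 i : `|b i 0| <= 1.
  by case: (split_ordP i) => j ->; rewrite ?bE ?normr0// l2norm1_entry.
have aa : (a^T *m a) 0 0 = 1.
  rewrite /a tr_col_mx mul_row_col trmx0 mul0mx addr0 mxE -[RHS](l2norm1_sum hu).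
  by apply: eq_bigr => i _; rewrite mxE expr2.
have bb : (b^T *m b) 0 0 = 1.
  rewrite /b tr_col_mx mul_row_col trmx0 mul0mx add0r mxE -[RHS](l2norm1_sum hv).
  by apply: eq_bigr => i _; rewrite mxE expr2.
have ab : (a^T *m b) 0 0 = 0.
  by rewrite /a /b tr_col_mx mul_row_col trmx0 mul0mx mulmx0 addr0 mxE.
have sq (x : 'cV[R]_n) : \sum_i x i 0 ^+ 2 = (x^T *m x) 0 0.
  by rewrite mxE; apply: eq_bigr => i _; rewrite mxE expr2.
have := @good_event d T R P n1 n2 H1 H2 cb sigma B L eps a b hcb n_gt1 s0 B0 L0 eps0
  N1 N2 ind sL BL _ ae _ be; rewrite !sq aa bb lexx => /(_ isT isT).
apply: with_probability_mono => // w [small pow bil] l1 l2 lead.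
set H := truncated_noise H1 H2 B w in pow bil.
(* On the good event truncation changes no entry, so [Md w] is the rank-two matrix plus the
   truncated noise itself. *)
have tr s : truncate B (noise_entry H1 H2 s w) = noise_entry H1 H2 s w.
  by rewrite /truncate small.
have MdE : Md w = H + lam *: (a *m b^T + b *m a^T).
  rewrite /Md /M1 /M2 /H /truncated_noise /a /b !tr_col_mx !mul_col_row !trmx0.
  rewrite !mulmx0 !mul0mx !add_block_mx scale_block_mx add_block_mx.
  rewrite !addr0 !add0r !scaler0 ?addr0 ?add0r; congr (block_mx _ _ _ _).
    rewrite addrC; congr (_ + _); apply/matrixP => i j; rewrite !mxE.
    exact/esym/(tr (inl (i, j))).
  rewrite /Mstar linearD /= linearZ /= trmx_mul trmxK addrC; congr (_ + _).
  apply/matrixP => i j; rewrite !mxE; exact/esym/(tr (inr (j, i))).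
pose N := log_steps R n; pose t := 24 * expR 1 ^+ 8 * L; pose rho := expR 1 ^+ 4 * t.
have e1 : 1 <= expR 1 :> R by rewrite -[leLHS]expR0 ler_expR.
have t0 : 0 <= t by rewrite !mulr_ge0 ?exprn_ge0 ?expR_ge0 ?(ltW L0).
have n_gt0 : (0 < n)%N := ltnW n_gt1.
have nb : n%:R <= expR 1 ^+ N := nat_le_expR_log_steps R n_gt0.
have rhoE : rho = K * L.
  by rewrite /rho /t /K (_ : 12 = 4 + 8)%N// exprD; ring.
have rho0 : 0 <= rho by rewrite rhoE mulr_ge0 ?(ltW K0) ?(ltW L0).
have e4 : expR 1 * t <= rho.
  by rewrite /rho ler_wpM2r// exprS ler_peMr ?expR_ge0// exprn_ege1.
have Hpow k i j : `|(H ^+ k) i j| <= rho ^+ k.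
  apply: (le_trans (@entry_power_le R n N H t (expR 1) isT t0 e1 nb pow k i j)).
  by apply: lerXn2r => //; rewrite nnegrE (mulr_ge0 (expR_ge0 1) t0).
have Hform x y : x \in [:: a; b] -> y \in [:: a; b] ->
    forall k, (0 < k)%N -> `|form H x y k| <= eps * rho ^+ k.
  move=> xab yab k k0.
  have one z : z \in [:: a; b] -> forall i, `|z i 0| <= 1.
    by rewrite !inE => /orP[] /eqP ->; [exact: a1|exact: b1].
  apply: (@bilinear_power_le R n N H t (expR 1) n_gt0 isT t0 e1 nb pow) => //.
  - exact: one.
  - exact: one.
  - by move=> k' k'N; exact: bil.
have rl : 800 * rho <= lam.
  have c0 : 0 < 800 * K by apply: mulr_gt0; [rewrite ltr0n|exact: K0].
  by rewrite rhoE mulrA -(ler_pdivlMl _ _ c0) -(ler_pdivrMr _ _ lam0).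
rewrite MdE in lead.
have := @leading_eigenvalues_close R n H a b lam eps rho lam0 (ltW eps0) eps2 rho0 rl
  Hpow aa bb ab Hform l1 l2 lead.
move=> /le_trans; apply; rewrite le_eqVlt; apply/orP; left; apply/eqP.
rewrite rhoE /eps; ring.
Qed.
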